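(* A team of $3$ synchronous agents is necessary and sufficient to solve PerpExploration-BBH on a ring $R$ with $n$ nodes, when each node of $R$ has a whiteboard of $O(\log n)$ bits of memory, irrespective of the starting locations of the agents. That is: (sufficiency) there is a deterministic algorithm for three agents which solves PerpExploration-BBH on every oriented ring with such whiteboards and for every initial placement of the agents on safe nodes (co-located or scattered); (necessity) no deterministic algorithm for fewer than three agents does so.
   Context: Model. $R=\{v_0,\dots,v_{n-1}\}$ is a ring with unlabeled nodes; node $v_i$ has two ports, leading to $v_{(i-1)\bmod n}$ and $v_{(i+1)\bmod n}$, consistently labeled left and right. Agents know $n$, have distinct IDs (from $[0,k^c]$, where $k$ is the number of agents and $c$ a constant), have $O(\log n)$ bits of internal memory, and all run the same deterministic algorithm. Agents are co-located if they all start at one common node, and scattered if they initially occupy more than one node (several agents may share a starting node). Time proceeds in synchronous rounds; in each round every agent at a node $v$ takes a snapshot (the two ports, the content of the whiteboard of $v$, its own memory, the IDs of the agents currently at $v$), then performs a communication step (reading/writing the whiteboard of $v$) and a move step (stay, or move through a port, being at the corresponding neighbour in the next round). Agents crossing the same edge in opposite directions do not notice each other. A whiteboard is a memory of $O(\log n)$ bits at each node, which agents at that node can read and modify in mutual exclusion; whiteboards are initially blank. Byzantine black hole. Exactly one node $v_b$ is a Byzantine black hole; all other nodes are safe; its position is fixed and unknown to the agents, and may be any node that is not a starting node of an agent. At the beginning of each round an adversary (who knows the algorithm) decides whether $v_b$ is active during that round. If active, all agents at $v_b$ in that round are destroyed without trace, and the adversary may additionally choose to erase the information stored at $v_b$.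 If not active, $v_b$ behaves exactly like a safe node. PerpExploration-BBH: the agents must move so that every node of $R$ except $v_b$ is visited by at least one agent infinitely often. An algorithm solves the problem if this holds for every ring size $n$, every initial placement, every admissible position of $v_b$ and every behaviour of the adversary. *)

(* Defs.v *)
From mathcomp Require Import all_boot.

Set Implicit Arguments.
Unset Strict Implicit.
Unset Printing Implicit Defensive.

(* Identifiers of k agents: the integers of [0, k ^ c]. *)
Definition agent_id (k c : nat) := 'I_(k ^ c).+1.

Inductive action := Stay | GoLeft | GoRight.

Definition move_to n (v : 'I_n) (a : action) : 'I_n :=
  match a with
  | Stay => v
  | GoLeft => ord_pred v
  | GoRight => ordS v
  end.

(* A deterministic algorithm run by every agent.  It may depend on n, and is
   given the identifier of the agent executing it as a read-only input.
   [step A n x m ids w0 w = (m', w', a)] is what agent [x] does in one round: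
   - [m] is its memory, and [ids], [w0] are the identifiers present at its node
     (its own included) and the content of the whiteboard there, as recorded in
     the snapshot at the beginning of the round;
   - [w] is the content of the whiteboard when [x] is granted exclusive access,
     which differs from [w0] if agents served before [x] modified it;
   - [x] replaces [w] by [w'], its memory by [m'], and then performs [a].
   The two ports carry no information, as they are labelled consistently. *)
Record algorithm (k c : nat) := Algorithm {
  mem_bits : nat -> nat;
  wb_bits : nat -> nat;
  mem0 : forall n, (mem_bits n).-tuple bool;
  step : forall n, agent_id k c -> (mem_bits n).-tuple bool ->
           {set agent_id k c} ->
           (wb_bits n).-tuple bool -> (wb_bits n).-tuple bool ->
           (mem_bits n).-tuple bool * (wb_bits n).-tuple bool * action }.

(* Whiteboards and agent memories have O(log n) bits. *)
Definition log_space k c (A : algorithm k c) : Prop :=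
  exists C : nat, forall n, 3 <= n ->
    mem_bits A n <= C * trunc_log 2 n /\ wb_bits A n <= C * trunc_log 2 n.

(* [pos s i = None] means that agent i has been destroyed. *)
Record config (k n : nat) (M W : Type) := Config {
  pos : {ffun 'I_k -> option 'I_n};
  mem : {ffun 'I_k -> M};
  board : {ffun 'I_n -> W} }.

Definition update (I : finType) (T : Type) (f : {ffun I -> T}) (i : I) (y : T)
  : {ffun I -> T} := [ffun j => if j == i then y else f j].

Section Execution.

Variables (k c : nat) (A : algorithm k c) (n : nat).
Variable ident : 'I_k -> agent_id k c.
Variable start : 'I_k -> 'I_n.
Variable vb : 'I_n.
(* The adversary: [active t] tells whether vb is active in round t, and
   [erase t] whether it then also erases the whiteboard of vb. *)
Variables (active erase : nat -> bool).
(* The order in which agents access whiteboards in round t; only the relative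
   order of co-located agents matters. *)
Variable order : nat -> seq 'I_k.

Notation memory := ((mem_bits A n).-tuple bool).
Notation whiteboard := ((wb_bits A n).-tuple bool).
Notation conf := (config k n memory whiteboard).

Definition blank : whiteboard := [tuple of nseq (wb_bits A n) false].

Definition init_config : conf :=
  Config [ffun i => Some (start i)] [ffun=> mem0 A n] [ffun=> blank].

Definition strike (t : nat) (s : conf) : conf :=
  if active t then
    Config [ffun i => if pos s i == Some vb then None else pos s i] (mem s)
      (if erase t then update (board s) vb blank else board s)
  else s.

Definition ids_at (s : conf) (v : 'I_n) : {set agent_id k c} :=
  [set ident i | i in 'I_k & pos s i == Some v].

(* The turn of agent i in a round: [s] is the configuration of which snapshots
   were taken, [s'] the one resulting from the turns already played.  Moves
   recorded in [s'] take effect in the next round, since presence is always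
   read in [s]. *)
Definition turn (s s' : conf) (i : 'I_k) : conf :=
  if pos s i is Some v then
    let: (m, w, a) :=
      step (ident i) (mem s i) (ids_at s v) (board s v) (board s' v) in
    Config (update (pos s') i (Some (move_to v a))) (update (mem s') i m)
      (update (board s') v w)
  else s'.

Definition next_config (t : nat) (s : conf) : conf :=
  let s1 := strike t s in foldl (turn s1) s1 (order t).

(* Configuration at the beginning of round t. *)
Fixpoint config_at (t : nat) : conf :=
  if t is t'.+1 then next_config t' (config_at t') else init_config.

Definition perpetually_explored : Prop :=
  forall v : 'I_n, v != vb ->
  forall t : nat, exists2 t', t <= t' &
    exists i : 'I_k, pos (config_at t') i = Some v.

End Execution.

(* Starting positions are arbitrary: co-located or scattered. *)
Definition solves_PerpExploration_BBH k c (A : algorithm k c) : Prop :=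
  forall n : nat, 3 <= n ->
  forall ident : 'I_k -> agent_id k c, injective ident ->
  forall (start : 'I_k -> 'I_n) (vb : 'I_n), (forall i, start i != vb) ->
  forall (active erase : nat -> bool) (order : nat -> seq 'I_k),
    (forall t, perm_eq (order t) (enum 'I_k)) ->
  perpetually_explored A ident start vb active erase order.

(* Main.v *)
Require Import Defs.
From mathcomp Require Import all_boot.
From mathcomp Require Import zify.

Set Implicit Arguments.
Unset Strict Implicit.
Unset Printing Implicit Defensive.

(* Starting nodes are safe and clocks agree, so time is cut
   into trips of 4n rounds.  The agent [a] of smallest identifier tours the ring
   alone, to the right in even trips and to the left in odd ones, writing the
   direction of the trip on every node; the others wait at home.  If [a] dies, a
   waiting agent that misses it in a rightward (leftward) trip knows that the black
   hole is on its left (right), hence reaches the home of [a] safely by walking right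
   (left).  At that home, the direction of the last trip tells on which side the
   nodes preceding the black hole carry a fresh mark while the black hole does not.
   Two agents then advance together on that side, one probing the next node and
   coming back if it is freshly marked.  When the probing agent does not come back,
   the other one is next to the black hole and explores the rest of the ring forever.

   Identifiers of other agents are unknown.  An agent that has not met any explorer
   before its own slot (a trip determined by its identifier) starts to tour in turn:
   either it is [a], or [a] died in its first trip on the left of that agent, which
   then finds the flag raised at the home of [a] before meeting the black hole, goes
   back home telling the agents on its way to go right, and returns to the flag.

   Lower bound.  Two agents start together at node 0 of a ring of 4 nodes, the black
   hole being dormant.  If one of them moves from [u] to [u'], both different from 0,
   the other one cannot distinguish its death at [u] from its death at [u'] one round
   later without visiting [u], so the adversary prevents [u] from being explored in
   the second case.  Hence node 2 is never reached. *)

(** * The algorithm *)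
Section BitCoding.

Variables (F : finType) (b : nat).

(** Elements are coded by the bit string of the same rank. The default of [nth] is never reached
    when [#|F| <= 2 ^ b]. *)
Definition to_bits (x : F) : b.-tuple bool :=
  nth [tuple of nseq b false] (enum {: b.-tuple bool}) (enum_rank x).

Definition of_bits (x0 : F) (u : b.-tuple bool) : F :=
  nth x0 (enum F) (index u (enum {: b.-tuple bool})).

Lemma to_bitsK x0 : #|F| <= 2 ^ b -> cancel to_bits (of_bits x0).
Proof.
move=> leF x; rewrite /of_bits /to_bits index_uniq ?enum_uniq ?nth_enum_rank //.
by rewrite -cardE card_tuple card_bool (leq_trans (ltn_ord _)).
Qed.

End BitCoding.

(* A mark is the direction ([true] for right) of the last trip of the explorer
   through the node. *)
Record board_state := BoardState { flag : bool; go : bool; mark : option bool }.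

(* [go] tells the agents waiting at the node that the explorer died on their left. *)
Definition raise_flag w := BoardState true (go w) (mark w).
Definition drop_flag w := BoardState false true (mark w).
Definition set_go w := BoardState (flag w) true (mark w).
Definition set_mark d w := BoardState (flag w) (go w) (Some d).

Definition board_bits (w : board_state) : 4.-tuple bool :=
  [tuple flag w; go w; mark w != None; mark w == Some true].

Definition bits_board (u : 4.-tuple bool) : board_state :=
  BoardState (tnth u (inord 0)) (tnth u (inord 1))
    (if tnth u (inord 2) then Some (tnth u (inord 3)) else None).

Lemma board_bitsK : cancel board_bits bits_board.
Proof.
by case=> f g [[]|]; rewrite /bits_board /board_bits !(tnth_nth false) !inordK.
Qed.

Definition blank_state := BoardState false false None.

Lemma bits_board_blank : bits_board [tuple of nseq 4 false] = blank_state.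
Proof. by rewrite /bits_board !(tnth_nth false) !inordK. Qed.

Section Algorithm.

Variable c : nat.
Notation id := (agent_id 3 c).

(** [Wait l s] remembers the explorer [l] once identified, and whether it came by during the current
    trip. [Return] is a scout walking back from the flag it found. In [Advance], [Probe] and [Check]
    the first boolean distinguishes the probing agent, the second is the direction of the search.
    [Explore d j] has [j] moves left before turning back. *)
Inductive mode (n : nat) :=
  | Wait of option id & bool
  | Loop
  | Return
  | Gather of bool
  | Advance of bool & bool
  | Probe of bool & bool
  | Check of bool & bool
  | Explore of bool & 'I_n.+1.

Arguments Wait {n}. Arguments Loop {n}. Arguments Return {n}. Arguments Gather {n}.
Arguments Advance {n}. Arguments Probe {n}. Arguments Check {n}. Arguments Explore {n}.

Definition mode_code n : Type := ('I_8 * option id * (bool * bool) * 'I_n.+1)%type.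

Definition code_mode n (m : mode n) : mode_code n :=
  match m with
  | Wait l s => (inord 0, l, (s, false), ord0)
  | Loop => (inord 1, None, (false, false), ord0)
  | Return => (inord 2, None, (false, false), ord0)
  | Gather d => (inord 3, None, (d, false), ord0)
  | Advance b d => (inord 4, None, (b, d), ord0)
  | Probe b d => (inord 5, None, (b, d), ord0)
  | Check b d => (inord 6, None, (b, d), ord0)
  | Explore d j => (inord 7, None, (d, false), j)
  end.

Definition decode_mode n (u : mode_code n) : mode n :=
  let: (q, l, (b, d), j) := u in
  match val q with
  | 0 => Wait l b
  | 1 => Loop
  | 2 => Return
  | 3 => Gather b
  | 4 => Advance b d
  | 5 => Probe b d
  | 6 => Check b d
  | _ => Explore b j
  end.

Lemma code_modeK n : cancel (@code_mode n) (@decode_mode n).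
Proof. by case=> *; rewrite /= inordK. Qed.

Definition dir_action (d : bool) := if d then GoRight else GoLeft.

(** Even, so that reducing the clock preserves the parity of trips; larger than every [2 * (y + 1)],
    so that trip numbers up to any slot are left unchanged. *)
Definition trips := (3 ^ c + 3).*2.
Definition period n := trips * (4 * n).

(* Time is divided into trips of [4 * n] rounds, and [agent_step] describes round
   [r] of trip [tau]; even trips go to the right,
     and the agent of identifier [y] may become the explorer at the start of trip
   [2 * (y + 1)]. *)
Definition agent_step n (x : id) (tau r : nat) (m : mode n) (ids : {set id})
    (w0 : board_state) : mode n * (board_state -> board_state) * action :=
  let d := ~~ odd tau in
  match m with
  | Wait l s =>
    let l' := if l is None then [pick y in ids | tau == (val y).+1.*2] else l in
    let s' := s || (if l' is Some y then y \in ids else false) in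
    if go w0 then (Gather true, idfun, Stay)
    else if r.+1 < 4 * n then (Wait l' s', idfun, Stay)
    else if l' is Some _ then
      (if s' then Wait l' false else Gather d, idfun, Stay)
    else if tau == (val x).*2.+1 then (Loop, raise_flag, Stay)
    else (Wait None false, idfun, Stay)
  | Loop =>
    if r < n then
      if (0 < r) && flag w0 then (Return, idfun, GoLeft)
      else (Loop, set_mark d, dir_action d)
    else (Loop, idfun, Stay)
  | Return =>
    if flag w0 then (Gather true, drop_flag, Stay) else (Return, set_go, GoLeft)
  | Gather d' =>
    if flag w0 then
      if (r == 0) && (ids != [set x]) then
        if mark w0 is Some e then
          (Advance [forall y in ids, val x <= val y] e, idfun, Stay)
        else (m, idfun, Stay)
      else (m, idfun, Stay)
    else (m, idfun, dir_action d')
  | Advance b e => (Probe b e, idfun, if b then dir_action e else Stay)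
  | Probe b e =>
    if b then
      if mark w0 == Some e then (Check b e, idfun, dir_action (~~ e))
      else (Explore e (inord (n - 2)), idfun, dir_action e)
    else (Check b e, idfun, Stay)
  | Check b e =>
    if ~~ b && (ids == [set x]) then
      (Explore (~~ e) (inord (n - 2)), idfun, Stay)
    else (Advance b e, idfun, dir_action e)
  | Explore e j =>
    (if val j <= 1 then Explore (~~ e) (inord (n - 2)) else Explore e (inord j.-1),
     idfun, dir_action e)
  end.

(** * Encoding of the agent memory in logarithmic space *)

Definition memory_code n : Type := ('I_(period n).+1 * mode_code n)%type.

(** Of the form [K + 4]: there are at most [K * n ^ 2] memory states, and [n ^ 2 <= 2 ^ (4 * L)] for
    [L = trunc_log 2 n >= 1]. In [K], the last 8 covers the two booleans and the bound
    [n.+1 <= 2 * n]. *)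
Definition log_factor := (8 * (trips * 4).+1 * (3 ^ c).+2 * 8).+4.

Definition memory_bits n := log_factor * trunc_log 2 n.

Definition code_memory n (t : nat) (m : mode n) : (memory_bits n).-tuple bool :=
  to_bits (memory_bits n) (inord t : 'I_(period n).+1, code_mode m).

Definition decode_memory n (u : (memory_bits n).-tuple bool) : nat * mode n :=
  let: (t, m) := of_bits (ord0 : 'I_(period n).+1, code_mode (Wait None false)) u in
  (val t, decode_mode m).

Lemma card_memory_code n : 3 <= n -> #|{: memory_code n}| <= 2 ^ memory_bits n.
Proof.
move=> n3.
have lt_n : n < 2 ^ (trunc_log 2 n).+1 by apply: trunc_log_ltn.
have log_gt0 : 0 < trunc_log 2 n by rewrite trunc_log_gt0; lia.
rewrite !card_prod card_option !card_ord card_bool /memory_bits /log_factor.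
set K := 8 * (trips * 4).+1 * _ * _; set L := trunc_log 2 n in lt_n log_gt0 *.
have le1 : (period n).+1 <= (trips * 4).+1 * n by rewrite /period; nia.
have le2 : n.+1 <= 2 * n by lia.
apply: (@leq_trans (K * n ^ 2)).
  apply: leq_trans (leq_mul le1 (leq_mul (leqnn _) le2)) _.
  rewrite /K; move: (trips) (3 ^ c) => u v; rewrite expnS expn1; lia.
have leK : K <= 2 ^ K by rewrite ltnW // ltn_expl.
have len2 : n ^ 2 <= 2 ^ (4 * L).
  apply: (@leq_trans ((2 ^ L.+1) ^ 2)); first by rewrite leq_exp2r // ltnW.
  by rewrite -expnM leq_exp2l //; lia.
apply: leq_trans (leq_mul leK len2) _; rewrite -expnD leq_exp2l //.
by move: (K) => K'; nia.
Qed.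

Lemma code_memoryK n t m : 3 <= n -> t <= period n ->
  decode_memory (@code_memory n t m) = (t, m).
Proof.
move=> n3 le_t; rewrite /decode_memory /code_memory to_bitsK ?card_memory_code //.
by rewrite code_modeK /= inordK.
Qed.

(** Mode and move depend only on the snapshot [w0]; the current board [w] is merely transformed by
    [f]. Hence the serving order affects nothing but the composition of the writes. *)
Definition ring_algorithm : algorithm 3 c :=
  @Algorithm 3 c memory_bits (fun=> 4) (fun n => code_memory 0 (Wait None false))
    (fun n x u ids w0 w =>
       let: (t, m) := decode_memory u in
       let: (m', f, a) := agent_step x (t %/ (4 * n)) (t %% (4 * n)) m ids (bits_board w0) in
       (code_memory (t.+1 %% period n) m', board_bits (f (bits_board w)), a)).

Lemma log_space_ring_algorithm : log_space ring_algorithm.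
Proof.
exists log_factor => n n3; split=> //=.
have log_gt0 : 0 < trunc_log 2 n by rewrite trunc_log_gt0; lia.
rewrite /log_factor; nia.
Qed.

End Algorithm.

Arguments Wait {c n}. Arguments Loop {c n}. Arguments Return {c n}. Arguments Gather {c n}.
Arguments Advance {c n}. Arguments Probe {c n}. Arguments Check {c n}. Arguments Explore {c n}.

(** * One round of the execution *)

Section Turns.

Variables (k c : nat) (A : algorithm k c) (n : nat) (ident : 'I_k -> agent_id k c).
Notation conf := (config k n ((mem_bits A n).-tuple bool) ((wb_bits A n).-tuple bool)).

Lemma foldl_turn_board (s s' : conf) (l : seq 'I_k) v :
  board (foldl (turn ident s) s' l) v =
  foldl (fun w i => if pos s i == Some v then
    (step (ident i) (Defs.mem s i) (ids_at ident s v) (board s v) w).1.2 else w)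
  (board s' v) l.
Proof.
elim: l s' => //= i l IH s'; rewrite IH /turn; congr foldl.
case: (pos s i) => [u|] //=; rewrite (inj_eq (@Some_inj _)).
case E: (step _ _ _ _ _) => [[m w] a] /=; rewrite ffunE eq_sym.
by have [eq_uv|//] := eqVneq u v; rewrite -eq_uv E.
Qed.

(** Only its own turn changes an agent, and that turn reads [s]. The board [w] it finds stays
    existential because it depends on the agents served earlier. *)
Lemma foldl_turn_agent (s s' : conf) (l : seq 'I_k) i : uniq l ->
  pos s' i = pos s i -> Defs.mem s' i = Defs.mem s i ->
  let s'' := foldl (turn ident s) s' l in
  if (i \in l) && (pos s i != None) then
    exists2 v, pos s i = Some v & exists w,
      let u := step (ident i) (Defs.mem s i) (ids_at ident s v) (board s v) w in
      pos s'' i = Some (move_to v u.2) /\ Defs.mem s'' i = u.1.1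
  else pos s'' i = pos s i /\ Defs.mem s'' i = Defs.mem s i.
Proof.
elim/last_ind: l => [|l j IH] /=; first by move=> _ -> ->.
rewrite rcons_uniq -cats1 foldl_cat mem_cat mem_seq1 /= => /andP[jl Ul] ps ms.
move: (IH Ul ps ms) => {IH}; set s1 := foldl _ _ _.
have [->{i ps ms}|ij] := eqVneq i j.
  rewrite (negbTE jl) orbT /= /turn; case Ep: (pos s j) => [v|] //= [p1 m1].
  exists v => //; exists (board s1 v).
  by case: (step _ _ _ _ _) => [[m w] a] /=; rewrite !ffunE eqxx.
rewrite orbF /turn.
case: (pos s j) => [v|] //; case: (step _ _ _ _ _) => [[m w] a] /=.
by rewrite !ffunE (negbTE ij).
Qed.

End Turns.

Section Run.

Variables (c n : nat) (ident : 'I_3 -> agent_id 3 c) (start : 'I_3 -> 'I_n) (vb : 'I_n).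
Variables (active erase : nat -> bool) (order : nat -> seq 'I_3).
Hypothesis n3 : 3 <= n.
Hypothesis ident_inj : injective ident.
Hypothesis start_safe : forall i, start i != vb.
Hypothesis orderP : forall t, perm_eq (order t) (enum 'I_3).

Notation A := (ring_algorithm c).

Definition run_config t := config_at A ident start vb active erase order t.
Definition struck_config t := strike vb active erase t (run_config t).

Definition agent_pos t i := pos (run_config t) i.
Definition struck_pos t i := pos (struck_config t) i.
Definition agent_mode t i : mode c n := (decode_memory (Defs.mem (run_config t) i)).2.
Definition node_board t v := bits_board (board (run_config t) v).
Definition struck_board t v := bits_board (board (struck_config t) v).
Definition present t v := ids_at ident (struck_config t) v.
Definition performed t i v :=
  agent_step (ident i) (t %% period c n %/ (4 * n)) (t %% period c n %% (4 * n)) (agent_mode t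
    i) (present t v) (struck_board t v).

Lemma struck_posE t i : struck_pos t i = if active t && (agent_pos t i == Some vb) then None
  else agent_pos t i.
Proof. by rewrite /struck_pos /struck_config /strike /agent_pos; case: (active t) => //=;
  rewrite ffunE. Qed.

Lemma struck_pos_safe t i v : v != vb -> agent_pos t i = Some v -> struck_pos t i = Some v.
Proof. by rewrite struck_posE => vvb ->; rewrite (inj_eq (@Some_inj _)) (negbTE vvb) andbF. Qed.

Lemma struck_pos_Some t i v : struck_pos t i = Some v -> agent_pos t i = Some v.
Proof. by rewrite struck_posE; case: ifP. Qed.

Lemma struck_pos_None t i : agent_pos t i = None -> struck_pos t i = None.
Proof. by rewrite struck_posE => ->; rewrite andbF. Qed.

Lemma struck_board_safe t v : v != vb -> struck_board t v = node_board t v.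
Proof.
move=> vvb; rewrite /struck_board /struck_config /strike; case: (active t) => //=.
by case: (erase t) => //=; rewrite ffunE (negbTE vvb).
Qed.

Lemma struck_board_cases t v : struck_board t v = node_board t v \/ struck_board t v =
  blank_state.
Proof.
rewrite /struck_board /node_board /struck_config /strike; case: (active t) => /=; last by left.
case: (erase t) => /=; last by left.
rewrite ffunE; case: ifP => _; last by left.
by right; apply: bits_board_blank.
Qed.

Lemma in_present t v i : (ident i \in present t v) = (struck_pos t i == Some v).
Proof.
rewrite /present /ids_at; apply/imsetP/idP => [[j]|Pi].
  by rewrite inE => /andP[_ Pj] /ident_inj->.
by exists i; rewrite // inE Pi.
Qed.

Lemma presentP t v y : reflect (exists2 i,
  y = ident i & struck_pos t i = Some v) (y \in present t v).
Proof.
apply: (iffP imsetP) => [[i]|[i -> /eqP Pi]].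
  by rewrite inE => /andP[_ /eqP Pi] ->; exists i.
by exists i => //; rewrite inE Pi.
Qed.

Lemma present_alone t v i : struck_pos t i = Some v ->
  (present t v == [set ident i]) = [forall j, (j != i) ==> (struck_pos t j != Some v)].
Proof.
move=> Pi; apply/eqP/forallP => [Eids j|H].
  apply/implyP => ji; rewrite -in_present Eids inE.
  by apply: contra ji => /eqP/ident_inj->.
apply/setP=> y; rewrite inE; apply/idP/eqP => [/presentP[j -> Pj]|->];
  last by rewrite in_present Pi.
by apply/eqP; apply: contraT => ji; move: (H j); rewrite Pj eqxx -(inj_eq ident_inj) ji.
Qed.

Lemma mem_struck_config t i : Defs.mem (struck_config t) i = Defs.mem (run_config t) i.
Proof. by rewrite /struck_config /strike; case: (active t). Qed.

Lemma node_board_0 v : node_board 0 v = blank_state.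
Proof. by rewrite /node_board /run_config /= ffunE; apply: bits_board_blank. Qed.

Lemma period_gt0 : 0 < period c n.
Proof. by rewrite /period /trips; have := expn_gt0 3 c; lia. Qed.

Lemma agent_mode_0 i : agent_mode 0 i = Wait None false.
Proof. by rewrite /agent_mode /run_config /= ffunE code_memoryK. Qed.

(** A living agent was alive in every earlier round, so it advanced its clock exactly once in
    each. *)
Lemma clockE t i : agent_pos t i != None ->
  (decode_memory (Defs.mem (run_config t) i)).1 = t %% period c n.
Proof.
have pg := period_gt0.
elim: t => [_|t IH].
  by rewrite /run_config /= ffunE code_memoryK // mod0n.
rewrite /agent_pos /run_config /= -/(run_config t) /next_config -/(struck_config t).
have U : uniq (order t) by rewrite (perm_uniq (orderP t)) enum_uniq.
have := @foldl_turn_agent _ _ _ _ ident (struck_config t) (struck_config t) (order t) i U erefl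
  erefl.
rewrite (perm_mem (orderP t)) mem_enum inE /= -/(struck_pos t i).
case Ep: (struck_pos t i) => [v|] /= [] => [v' [Ev'] [w [_ ->]] _|-> //].
rewrite mem_struck_config.
have : agent_pos t i != None by rewrite (struck_pos_Some Ep).
move=> /IH; case E: (decode_memory _) => [t' m] /= ->.
case: (agent_step _ _ _ _ _ _) => [[m' f] a] /=.
rewrite code_memoryK //=; last by rewrite ltnW // ltn_mod.
by rewrite -addn1 modnDml addn1.
Qed.

Lemma next_agent t i v : struck_pos t i = Some v ->
  agent_pos t.+1 i = Some (move_to v (performed t i v).2) /\
    agent_mode t.+1 i = (performed t i v).1.1.
Proof.
move=> Ep; rewrite /agent_pos /agent_mode /run_config /= -/(run_config t) /next_config
  -/(struck_config t).
have pg := period_gt0.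
have U : uniq (order t) by rewrite (perm_uniq (orderP t)) enum_uniq.
have := @foldl_turn_agent _ _ _ _ ident (struck_config t) (struck_config t) (order t) i U erefl
  erefl.
rewrite (perm_mem (orderP t)) mem_enum inE /= -/(struck_pos t i) Ep /= => -[_ [<-] [w]].
have : agent_pos t i != None by rewrite (struck_pos_Some Ep).
rewrite mem_struck_config /performed /agent_mode /present /struck_board => /clockE.
case: (decode_memory _) => [t' m] /= ->.
case: (agent_step _ _ _ _ _ _) => [[m' f] a] /= [-> ->].
by rewrite code_memoryK // ltnW // ltn_mod.
Qed.

Lemma next_dead t i : struck_pos t i = None -> agent_pos t.+1 i = None.
Proof.
move=> Ep; rewrite /agent_pos /run_config /= -/(run_config t) /next_config -/(struck_config t).
have U : uniq (order t) by rewrite (perm_uniq (orderP t)) enum_uniq.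
have := @foldl_turn_agent _ _ _ _ ident (struck_config t) (struck_config t) (order t) i U erefl
  erefl.
by rewrite (perm_mem (orderP t)) mem_enum inE /= -/(struck_pos t i) Ep /= => -[].
Qed.

Lemma next_board t v : node_board t.+1 v =
  foldl (fun w i => if struck_pos t i == Some v then (performed t i v).1.2 w else w)
    (struck_board t v) (order t).
Proof.
rewrite /node_board /run_config /= -/(run_config t) /next_config -/(struck_config t) /=
  (@foldl_turn_board _ _ A n ident) /struck_board.
elim: (order t) {2 3}(board (struck_config t) v) => //= i l IH u; rewrite {}IH; congr foldl.
rewrite -/(struck_pos t i); case: eqP => // Ep.
have : agent_pos t i != None by rewrite (struck_pos_Some Ep).
rewrite mem_struck_config /performed /agent_mode /present /struck_board => /clockE.
case: (decode_memory _) => [t' m] /= ->.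
by case: (agent_step _ _ _ _ _ _) => [[m' f] a] /=; rewrite board_bitsK.
Qed.

(** The observation [phi] is typically one field of the board, so that writes to the other fields
    can be ignored. *)
Lemma board_inv (T : Type) (phi : board_state -> T) t v :
  (forall i, struck_pos t i = Some v -> forall w, phi ((performed t i v).1.2 w) = phi w) ->
  phi (node_board t.+1 v) = phi (struck_board t v).
Proof.
move=> H; rewrite next_board; elim: (order t) (struck_board t v) => //= i l IH w.
by rewrite IH; case: eqP => // /H->.
Qed.

(** The serving order is irrelevant: the turn of [i] overrides earlier values of [phi], and later
    turns preserve it. *)
Lemma board_set (T : Type) (phi : board_state -> T) t v i x : struck_pos t i = Some v ->
  (forall w, phi ((performed t i v).1.2 w) = x) ->
  (forall j, j != i -> struck_pos t j = Some v -> forall w,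
    phi ((performed t j v).1.2 w) = phi w) ->
  phi (node_board t.+1 v) = x.
Proof.
move=> Pi Hi Hj; rewrite next_board.
have : i \in order t by rewrite (perm_mem (orderP t)) mem_enum.
elim: (order t) (struck_board t v) => //= j l IH w; rewrite inE => /orP[/eqP<-|];
  last exact: IH.
rewrite Pi eqxx; have := Hi w; elim: l {IH} (_ w) => //= h l IH u Eu.
apply: IH; have [->|hi] := eqVneq h i; first by case: eqP.
by case: eqP => // Ph; rewrite Hj.
Qed.

End Run.

Global Opaque node_board struck_board agent_mode present.

(** * Coordinates on the ring *)

Section Coordinates.

Variables (n : nat) (ha : 'I_n).

Definition nd k : 'I_n := iter k (@ordS n) ha.
Definition off (v : 'I_n) := (v + n - ha) %% n.

Lemma val_nd k : val (nd k) = (ha + k) %% n.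
Proof.
elim: k => [|k IH] /=; first by rewrite addn0 modn_small.
by rewrite -/(nd k) IH -addn1 modnDml addn1 addnS.
Qed.

Lemma off_lt v : off v < n.
Proof. by rewrite ltn_mod; case: n v => [[]|]. Qed.

Lemma nd_off v : nd (off v) = v.
Proof.
apply: val_inj; rewrite val_nd /off modnDmr.
have -> : ha + (v + n - ha) = v + n by have := ltn_ord ha; lia.
by rewrite modnDr modn_small.
Qed.

Lemma off_nd k : off (nd k) = k %% n.
Proof.
have hn := ltn_ord ha.
rewrite /off val_nd; apply/eqP.
rewrite -(eqn_modDl ha) (_ : ha + _ = (ha + k) %% n + n);
  last by have := ltn_pmod (ha + k) (leq_ltn_trans (leq0n _) hn); lia.
by rewrite modnDr modn_mod.
Qed.

(** Offsets range over [[0, n]] with both ends denoting [ha]: a rightward walk home ends at [n] and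
    a leftward one at 0, which avoids modular arithmetic. *)
Lemma nd_eq k v : k <= n -> (nd k == v) = (k == off v) || ((k == n) && (off v == 0)).
Proof.
move=> kn; have -> : (nd k == v) = (k %% n == off v).
  by apply/eqP/eqP => [<-|E]; rewrite ?off_nd // -[v]nd_off -E -off_nd nd_off.
have := off_lt v; case: (ltngtP k n) kn => // [kn _|-> _] vn; first by rewrite modn_small; lia.
by rewrite modnn; lia.
Qed.

Lemma nd_inj k l : k < n -> l < n -> nd k = nd l -> k = l.
Proof. by move=> kn ln E; rewrite -(modn_small kn) -(modn_small ln) -!off_nd E. Qed.

Lemma move_right k : move_to (nd k) GoRight = nd k.+1.
Proof. by []. Qed.

Lemma move_left k : 0 < k -> move_to (nd k) GoLeft = nd k.-1.
Proof. by case: k => //= k _; rewrite -/(nd k) ordSK. Qed.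

Lemma ndn : nd n = ha.
Proof. by apply: val_inj; rewrite val_nd modnDr modn_small. Qed.

(* Position after [r] steps in direction [d], as an offset in [0, n]. *)
Definition offd (d : bool) r := if d then r else n - r.

Lemma move_dir d r : r < n -> move_to (nd (offd d r)) (dir_action d) = nd (offd d r.+1).
Proof.
case: d => rn; first exact: move_right.
by rewrite [dir_action _]/= move_left /offd; [congr nd|]; lia.
Qed.

Lemma move_back d r : r < n -> move_to (nd (offd d r.+1)) (dir_action (~~ d)) = nd (offd d r).
Proof.
case: d => rn; first by rewrite [dir_action _]/= move_left.
by rewrite [dir_action _]/= move_right /offd; congr nd; lia.
Qed.

Lemma nd0 : nd 0 = ha. Proof. by []. Qed.

Lemma offd0 d : nd (offd d 0) = ha.
Proof. by case: d; rewrite //= subn0 ndn. Qed.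

Lemma offdn d : nd (offd d n) = ha.
Proof. by case: d; rewrite /offd ?subnn ?ndn. Qed.

End Coordinates.

(** * Correctness of the algorithm *)

Ltac branches := repeat (case: ifP => ?; try by [|exfalso; lia]).

Section Alive.

Variables (c n : nat) (ident : 'I_3 -> agent_id 3 c) (start : 'I_3 -> 'I_n) (vb : 'I_n).
Variables (active erase : nat -> bool) (order : nat -> seq 'I_3).
Hypothesis n3 : 3 <= n.
Hypothesis ident_inj : injective ident.
Hypothesis start_safe : forall i, start i != vb.
Hypothesis orderP : forall t, perm_eq (order t) (enum 'I_3).

Notation P := (@agent_pos c n ident start vb active erase order).
Notation P' := (@struck_pos c n ident start vb active erase order).
Notation md := (@agent_mode c n ident start vb active erase order).
Notation bd := (@node_board c n ident start vb active erase order).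
Notation bd' := (@struck_board c n ident start vb active erase order).
Notation ids := (@present c n ident start vb active erase order).
Notation act := (@performed c n ident start vb active erase order).

Variable a : 'I_3.
Hypothesis a_min : forall i, i != a -> val (ident a) < val (ident i).

Notation ha := (start a).
Notation nd := (nd ha).
Notation off := (off ha).

Definition tt tau r := tau * (4 * n) + r.

Lemma performed_tt tau r i v : r < 4 * n -> act (tt tau r) i v =
  agent_step (ident i) (tau %% trips c) r (md (tt tau r) i) (ids (tt tau r) v) (bd' (tt tau r)
    v).
Proof.
move=> r4; have n4 : 0 < 4 * n by lia.
rewrite /performed /period; congr agent_step.
  by rewrite -modn_divl /tt divnMDl // divn_small ?addn0.
by rewrite (modn_dvdm _ (dvdn_mull _ (dvdnn _))) /tt modnMDl modn_small.
Qed.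

Lemma odd_trip tau : odd (tau %% trips c) = odd tau.
Proof. by rewrite odd_mod // /trips odd_double. Qed.

Lemma ident_lt i : (val (ident i)).+1.*2 < trips c.
Proof. by have := ltn_ord (ident i); rewrite /trips /=; lia. Qed.

Lemma off_start_neq i : off (start i) != off vb.
Proof. by apply/eqP => E; have := start_safe i;
  rewrite -(nd_off ha (start i)) E nd_off eqxx. Qed.

Lemma off_ha : off ha = 0.
Proof. by rewrite -[X in off X]/(nd 0) off_nd mod0n. Qed.

Lemma off_vb_gt0 : 0 < off vb.
Proof. by have := off_start_neq a; rewrite off_ha lt0n eq_sym. Qed.

Lemma struck_pos_start t i : P t i = Some (start i) -> P' t i = Some (start i).
Proof. exact/struck_pos_safe/start_safe. Qed.

Lemma struck_board_start t i : bd' t (start i) = bd t (start i).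
Proof. exact/struck_board_safe/start_safe. Qed.

(** * Rounds preceding the first trip of the explorer *)

Definition trip0 := (val (ident a)).+1.*2.

Definition idle t := forall i, P t i = Some (start i) /\ md t i = Wait None false.

(** Since [a] has the least identifier, no slot occurs before [trip0]: nobody is taken for an
    explorer, and [a] alone starts, in the round just before its slot. *)
Lemma idle_act tau r i : r < 4 * n -> tau < trip0 -> idle (tt tau r) ->
  bd (tt tau r) (start i) = blank_state ->
  act (tt tau r) i (start i) =
  if (r.+1 == 4 * n) && (tau.+1 == trip0) && (i == a) then (Loop, raise_flag, Stay)
  else (Wait None false, idfun, Stay).
Proof.
move=> r4 ht I B; rewrite performed_tt // (I i).2 /=. rewrite struck_board_start B /=.
have tt_small : tau %% trips c = tau by rewrite modn_small //; have := ident_lt a;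
  rewrite -/trip0; lia.
rewrite tt_small; case: pickP => [y /andP[/presentP[j -> _] /eqP E]|_] /=.
  by exfalso; have [ja|/a_min] := eqVneq j a; move: ht E; rewrite /trip0 ?ja /=; lia.
have -> : (tau == (val (ident i)).*2.+1) = (tau.+1 == trip0) && (i == a).
  by move: ht; rewrite /trip0; have [->|/a_min] := eqVneq i a; lia.
have [r5|r5] := ltnP r.+1 (4 * n); first by rewrite ltn_eqF.
by have -> : (r.+1 == 4 * n) = true by lia.
Qed.

Lemma idle_until tau r : r < 4 * n -> tau < trip0 ->
  idle (tt tau r) /\ forall v, bd (tt tau r) v = blank_state.
Proof.
(* The induction is on the absolute round, because round 0 of a trip follows the last round of the
   preceding trip. *)
have [m] := ubnP (tt tau r); elim: m tau r => // m IH tau r lm r4 ht.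
have step tau' r' : tt tau' r' < m -> r' < 4 * n -> tau' < trip0 ->
    ~~ ((r'.+1 == 4 * n) && (tau'.+1 == trip0)) ->
    idle (tt tau' r').+1 /\ forall v, bd (tt tau' r').+1 v = blank_state.
  move=> lm' r4' ht' nlast; have [I B] := IH tau' r' lm' r4' ht'.
  have H i : act (tt tau' r') i (start i) = (Wait None false, idfun, Stay).
    by rewrite (idle_act r4' ht' I) ?B // (negbTE nlast).
  split=> [i|v].
    have Pi := struck_pos_start (I i).1.
    by have [-> ->] := next_agent n3 orderP Pi; rewrite H.
  rewrite (board_inv n3 orderP (phi := id)) => [|i Pi w].
    by have [->|->] := struck_board_cases ident start vb active erase order (tt tau' r') v;
      rewrite ?B.
  have := struck_pos_start (I i).1; rewrite Pi => -[->]; by rewrite H.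
case: r => [|r] in lm r4 *.
  case: tau => [|tau] in lm ht *.
    by split=> [i|v]; rewrite /tt mul0n ?node_board_0 ?agent_mode_0 ?/agent_pos ?ffunE.
  have -> : tt tau.+1 0 = (tt tau (4 * n).-1).+1 by rewrite /tt; lia.
  by apply: step; rewrite /tt in lm *; lia.
rewrite /tt addnS; apply: step; rewrite /tt in lm *; lia.
Qed.

Lemma first_trip : [/\ forall i, P (tt trip0 0) i = Some (start i),
  md (tt trip0 0) a = Loop,
  forall i, i != a -> md (tt trip0 0) i = Wait None false &
  forall v, bd (tt trip0 0) v = BoardState (v == ha) false None].
Proof.
have -> : tt trip0 0 = (tt trip0.-1 (4 * n).-1).+1 by rewrite /tt /trip0; lia.
have r4 : (4 * n).-1 < 4 * n by lia.
have ht : trip0.-1 < trip0 by rewrite /trip0; lia.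
have [I B] := idle_until r4 ht.
have H i : act (tt trip0.-1 (4 * n).-1) i (start i) =
    if i == a then (Loop, raise_flag, Stay) else (Wait None false, idfun, Stay).
  by rewrite (idle_act r4 ht I) ?B // !prednK ?eqxx // /trip0; lia.
have Pi i : P' (tt trip0.-1 (4 * n).-1) i = Some (start i) := struck_pos_start (I i).1.
split=> [i||i ia|v].
- by have [-> _] := next_agent n3 orderP (Pi i); rewrite H; case: ifP.
- by have [_ ->] := next_agent n3 orderP (Pi a); rewrite H eqxx.
- by have [_ ->] := next_agent n3 orderP (Pi i); rewrite H (negbTE ia).
have Bv : bd' (tt trip0.-1 (4 * n).-1) v = blank_state.
  by have [->|->] := struck_board_cases ident start vb active erase order (tt trip0.-1 (4 *
    n).-1) v; rewrite ?B.
have E w : w = BoardState (flag w) (go w) (mark w) by case: w.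
have act_eq i : P' (tt trip0.-1 (4 * n).-1) i = Some v ->
    act (tt trip0.-1 (4 * n).-1) i v = if i == a then (Loop, raise_flag,
      Stay) else (Wait None false, idfun, Stay).
  by rewrite Pi => -[<-].
rewrite (E (bd _ v)); congr BoardState.
- have [va|va] := eqVneq v ha; first rewrite va in act_eq *.
    apply: (board_set n3 orderP (phi := flag) (Pi a)) => [w|j ja Pj w]; first by rewrite H eqxx.
    by rewrite act_eq // (negbTE ja).
  rewrite (board_inv n3 orderP (phi := flag)) ?Bv ?(negbTE va) // => i Piv w; rewrite act_eq //.
  by case: eqP => // ia; move: Piv; rewrite Pi ia => -[Ev]; rewrite Ev eqxx in va.
- by rewrite (board_inv n3 orderP (phi := go)) ?Bv // => i Piv w; rewrite act_eq //; case: eqP.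
- by rewrite (board_inv n3 orderP (phi := mark)) ?Bv // => i Piv w; rewrite act_eq //;
  case: eqP.
Qed.

(** * Tours of the living explorer *)

Definition dir tau := ~~ odd tau.

(* Distance from the home of the explorer to the black hole in direction [d]. *)
Definition dist d := offd n d (off vb).

(* Round of a trip in direction [d] in which the explorer passes by agent [i]. *)
Definition visit d i :=
  if d || (off (start i) == 0) then off (start i) else n - off (start i).

(** [s] says that the explorer has already passed; if it died in this trip, it passed only the
    agents nearer than the black hole. Its identifier is learnt at that passage in the first trip,
    and is known in later ones. *)
Definition wait_mode tau r dead i : mode c n :=
  let s := (visit (dir tau) i < r) && (dead ==> (visit (dir tau) i < dist (dir tau))) in
  if (tau == trip0) && ~~ s then Wait None false else Wait (Some (ident a)) s.

(** Invariant within a trip, [dead] meaning that [a] died during it. By [tour_stale], the black hole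
    can receive the mark of the trip only if the explorer survives there, and that mark is the wrong
    one for the next trip; erasure only makes it blank. Thus at any death the nodes before the black
    hole carry the current direction and the black hole does not. *)
Record touring tau r dead : Prop := Touring {
  tour_pos : P (tt tau r) a = if dead then None else Some (nd (offd n (dir tau) (minn r n)));
  tour_md : ~~ dead -> md (tt tau r) a = Loop;
  tour_dead : dead -> dist (dir tau) < r;
  tour_wait : forall i, i != a ->
    P (tt tau r) i = Some (start i) /\ md (tt tau r) i = wait_mode tau r dead i;
  tour_flag : forall v, flag (bd (tt tau r) v) = (v == ha);
  tour_go : forall v, go (bd (tt tau r) v) = false;
  tour_fresh : forall k, k < minn r (dist (dir tau)) ->
    mark (bd (tt tau r) (nd (offd n (dir tau) k))) = Some (dir tau);
  tour_stale : mark (bd (tt tau r) vb) !=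
    Some (if (r <= dist (dir tau)) || dead then dir tau else ~~ dir tau) }.

Lemma dist_bounds d : 0 < dist d < n.
Proof. by have := off_vb_gt0; have := off_lt ha vb; rewrite /dist /offd; case: d; lia. Qed.

Lemma nd_offd_vb d r : r <= n -> (nd (offd n d r) == vb) = (r == dist d).
Proof.
move=> rn; have := off_vb_gt0; have := off_lt ha vb.
by rewrite nd_eq /dist /offd; case: d; lia.
Qed.

Lemma nd_offd_ha d r : r <= n -> (nd (offd n d r) == ha) = (r == 0) || (r == n).
Proof. by move=> rn; rewrite nd_eq ?off_ha /offd; case: d; lia. Qed.

Lemma nd_offd_start d r i : 
  (nd (offd n d (minn r n)) == start i) =
  (r == visit d i) || ((n <= r) && (visit d i == 0)).
Proof.
have := off_lt ha (start i).
rewrite nd_eq /visit /offd; last by case: d; lia.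
by case: d => /=; case: (off (start i) =P 0) => /=; lia.
Qed.

Lemma flag_struck_board t v : (forall u, flag (bd t u) = (u == ha)) ->
  flag (bd' t v) = (v == ha).
Proof.
move=> H; have [-> //|vha] := eqVneq v ha; first by rewrite struck_board_start H eqxx.
by have [->|->] := struck_board_cases ident start vb active erase order t v;
  rewrite ?H ?(negbTE vha).
Qed.

Lemma go_struck_board t v : go (bd t v) = false -> go (bd' t v) = false.
Proof. by have [->|->] := struck_board_cases ident start vb active erase order t v. Qed.

Section TouringStep.

Variables (tau r : nat) (dead : bool).
Hypotheses (tau0 : trip0 <= tau) (r4 : r < 4 * n) (H : touring tau r dead).

Let d := dir tau.
Let t := tt tau r.
Let dead' := P' t a == None.

Let dead_dead' : dead -> dead'.
Proof. by move=> De; rewrite /dead' struck_pos_None // (tour_pos H) De. Qed.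

Let pos_a' : P' t a = if dead' then None else Some (nd (offd n d (minn r n))).
Proof.
rewrite /dead' struck_posE (tour_pos H); case: (dead); rewrite ?andbF //.
by case: ifP.
Qed.

(** A tour meets the black hole in a single round. *)
Let dead_at : dead' -> ~~ dead -> r = dist d.
Proof.
move=> + /negbTE de; rewrite /dead' struck_posE (tour_pos H) de.
case: ifP => // /andP[_]; rewrite (inj_eq (@Some_inj _)) nd_offd_vb ?geq_minr //.
by have := dist_bounds d; rewrite -/d; lia.
Qed.

Let pos_i' i : i != a -> P' t i = Some (start i).
Proof. by move=> ia; apply/struck_pos_start/(tour_wait H ia).1. Qed.

(** The only flag is at [ha], where the explorer stands at round 0 and from round [n] on, so it
    never enters [Return]. *)
Let act_a : ~~ dead' -> act t a (nd (offd n d (minn r n))) =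
  if r < n then (Loop, set_mark d, dir_action d) else (Loop, idfun, Stay).
Proof.
move=> de; rewrite performed_tt // -/t (tour_md H) /=; last by apply: contra de => /dead_dead'.
rewrite flag_struck_board; last exact: (tour_flag H).
rewrite nd_offd_ha ?geq_minr // odd_trip -/(dir tau) -/d.
by case: ltnP => // rn; case: ifP => // ?; exfalso; lia.
Qed.

Let saw i := (~~ dead' && (nd (offd n d (minn r n)) == start i)).

Let sawE i : i != a -> wait_mode tau r.+1 dead' i =
  if (tau == trip0) && ~~ ((visit d i < r) && (dead ==> (visit d i < dist d)) || saw i)
  then Wait None false
  else Wait (Some (ident a)) ((visit d i < r) && (dead ==> (visit d i < dist d)) || saw i).
Proof.
move=> ia; rewrite /wait_mode -/d.
suff -> : (visit d i < r.+1) && (dead' ==> (visit d i < dist d)) =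
  (visit d i < r) && (dead ==> (visit d i < dist d)) || saw i by [].
rewrite /saw nd_offd_start; have := dead_at; have := dead_dead'; have := tour_dead H.
rewrite -/d; case: (dead) => /=; case: (dead') => /= h1 h2 h3; lia.
Qed.

Let in_ids_a i : (ident a \in ids t (start i)) = saw i.
Proof. by rewrite in_present // pos_a' /saw; case: (dead');
  rewrite ?(inj_eq (@Some_inj _)). Qed.

Let act_i i : i != a -> act t i (start i) =
  if r.+1 < 4 * n then (wait_mode tau r.+1 dead' i, idfun, Stay)
  else if wait_mode tau r.+1 dead' i is Wait (Some y) s then
    (if s then Wait (Some y) false else Gather d, idfun, Stay)
  else (Wait None false, idfun, Stay).
Proof.
move=> ia; rewrite performed_tt // -/t (tour_wait H ia).2 sawE // {1}/wait_mode -/d.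
set s := (_ < r) && _.
have gof : go (bd' t (start i)) = false by apply/go_struck_board/(tour_go H).
case: ifPn => [/andP[/eqP t0 /negbTE ->]|ns].
  rewrite /= gof t0 modn_small ?(ident_lt a) // eqxx /=.
  case: pickP => [y /andP[yi /eqP E]|nopick].
    have Ey : y = ident a by apply: val_inj => /=; move: E; rewrite /trip0 /=; clear; lia.
    by rewrite Ey in_ids_a; move: yi; rewrite Ey in_ids_a => ->.
  have -> : saw i = false.
    by move: (nopick (ident a)); rewrite eqxx andbT in_ids_a.
  (* New tours are decided at the end of odd trips, and [trip0] is even. *)
  have -> : (trip0 == (\val (ident i)).*2.+1) = false by rewrite /trip0; lia.
  by case: ifP.
rewrite /= gof odd_trip in_ids_a -/(dir tau) -/d.
have -> : (tau == trip0) && ~~ (s || saw i) = false by move: ns; case: (s);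
  rewrite /= ?andbF // andbT => /negbTE->.
by case: ifP.
Qed.

Let agents' : P t.+1 a = (if dead' then None else Some (nd (offd n d (minn r.+1 n)))) /\
  (~~ dead' -> md t.+1 a = Loop).
Proof.
move: pos_a' act_a; case: (dead') => [pa _|pa aa]; first by rewrite (next_dead orderP pa).
have [-> ->] := next_agent n3 orderP pa; rewrite aa //.
case: ltnP => rn; split=> //; congr Some.
  by rewrite (minn_idPl rn) move_dir.
by rewrite (minn_idPr (leqW rn)).
Qed.

Let act_at i v : P' t i = Some v -> i != a -> (act t i v).1.2 = idfun.
Proof.
move=> + ia; rewrite (pos_i' ia) => -[<-]; rewrite act_i //.
by case: ifP => // _; case: wait_mode => // -[].
Qed.

Let flags' v : flag (bd t.+1 v) = (v == ha).
Proof.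
rewrite (board_inv n3 orderP (phi := flag)) ?flag_struck_board //; first exact: (tour_flag H).
move=> i Pi w; have [ia|ia] := eqVneq i a; last by rewrite act_at.
move: Pi; rewrite ia pos_a'; move: act_a; case: (dead') => // aa [<-].
by rewrite aa //; case: ifP.
Qed.

Let gos' v : go (bd t.+1 v) = false.
Proof.
rewrite (board_inv n3 orderP (phi := go)) ?go_struck_board //; first exact: (tour_go H).
move=> i Pi w; have [ia|ia] := eqVneq i a; last by rewrite act_at.
move: Pi; rewrite ia pos_a'; move: act_a; case: (dead') => // aa [<-].
by rewrite aa //; case: ifP.
Qed.

Let marks' v : mark (bd t.+1 v) =
  if [&& ~~ dead', r < n & v == nd (offd n d r)] then Some d else mark (bd' t v).
Proof.
case: ifPn => [/and3P[de rn /eqP Ev]|].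
  have aa := act_a de; move: pos_a'; rewrite (negbTE de) => pa.
  rewrite rn (minn_idPl (ltnW rn)) -Ev in aa pa.
  apply: (board_set n3 orderP (phi := mark) pa) => [w|j ja Pj w]; first by rewrite aa.
  by rewrite act_at.
move=> nv; apply: (board_inv n3 orderP (phi := mark)) => i Pi w.
have [ia|ia] := eqVneq i a; last by rewrite act_at.
move: nv Pi; rewrite ia pos_a'; move: act_a; case: (dead') => // aa nv [Ev].
by move: nv; rewrite -Ev aa //; case: ltnP => //= rn; rewrite eqxx.
Qed.

Let fresh' k : k < minn r.+1 (dist d) -> mark (bd t.+1 (nd (offd n d k))) = Some d.
Proof.
move=> kr; rewrite marks'; case: ifPn => // nv.
have kn : k <= n by have := dist_bounds d; lia.
rewrite struck_board_safe ?nd_offd_vb //; last by lia.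
have [kr'|kr'] := eqVneq k r; last by apply: (tour_fresh H); rewrite -/d; lia.
exfalso; rewrite kr' in kr nv; move: nv; have rd : r < dist d by lia.
have := dist_bounds d; rewrite eqxx andbT => db.
have -> : r < n by lia.
rewrite andbT negbK => de; case: (boolP dead) => [/(tour_dead H)|/(dead_at de)]; rewrite -/d;
  lia.
Qed.

Let stale' : mark (bd t.+1 vb) != Some (if (r.+1 <= dist d) || dead' then d else ~~ d).
Proof.
rewrite marks'; have db := dist_bounds d.
have keep e : mark (bd t vb) != Some e -> mark (bd' t vb) != Some e.
  by have [->|->] := struck_board_cases ident start vb active erase order t vb.
case: ifPn => [/and3P[de rn vr]|nv].
  have rd : r == dist d by rewrite -nd_offd_vb // 1?eq_sym // ltnW.
  by rewrite (negbTE de) (eqP rd) ltnn /=; case: (d).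
apply: keep; have := tour_stale H; rewrite -/t -/d.
suff -> : (r <= dist d) || dead = (r.+1 <= dist d) || dead' by [].
have := dead_at; have := dead_dead'; have := tour_dead H; move: nv; rewrite -/d.
rewrite eq_sym; have [rn|rn] := ltnP r n; last by case: (dead); case: (dead') => /=; lia.
by rewrite nd_offd_vb ?(ltnW rn) //; case: (dead); case: (dead') => /=; lia.
Qed.

Lemma touring_step : r.+1 < 4 * n -> touring tau r.+1 dead'.
Proof.
move=> r5; rewrite /tt; split; rewrite -/d /tt ?addnS -/(tt tau r) -/t //.
- by have [] := agents'.
- by have [] := agents'.
- move=> de; case: (boolP dead) => [/(tour_dead H)|/(dead_at de)]; rewrite -/d; lia.
- move=> i ia; have [-> ->] := next_agent n3 orderP (pos_i' ia).
  by rewrite act_i // r5.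
Qed.

Lemma touring_last : r.+1 = 4 * n ->
  [/\ P t.+1 a = (if dead' then None else Some ha), ~~ dead' -> md t.+1 a = Loop,
    forall i, i != a -> P t.+1 i = Some (start i) /\
      md t.+1 i = (if wait_mode tau r.+1 dead' i is Wait (Some y) s then
        if s then Wait (Some y) false else Gather d else Wait None false),
    forall v, flag (bd t.+1 v) = (v == ha) /\ go (bd t.+1 v) = false &
    (forall k, k < dist d -> mark (bd t.+1 (nd (offd n d k))) = Some d) /\
    mark (bd t.+1 vb) != Some (if dead' then d else ~~ d)].
Proof.
move=> r5; have db := dist_bounds d; split=> //; try by have [] := agents'.
- have [-> _] := agents'; case: (dead') => //.
  have -> : minn r.+1 n = n by lia.
  by rewrite offdn.
- move=> i ia; have [-> ->] := next_agent n3 orderP (pos_i' ia).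
  rewrite act_i // r5 ltnn.
  by split; case: (wait_mode _ _ _ _) => // -[y|] [].
split; first by move=> k kd; apply: fresh'; lia.
have := stale'; have -> : (r < dist d) = false by lia.
by [].
Qed.

End TouringStep.

Lemma tt_next tau : tt tau.+1 0 = tt tau (4 * n).
Proof. by rewrite /tt mulSn addn0 addnC. Qed.

Lemma touring_start : touring trip0 0 false.
Proof.
have [Pi Pa Pw B] := first_trip; have d0 : dir trip0 = true by rewrite /dir /trip0 odd_double.
split=> //=.
- by rewrite min0n offd0.
- by move=> i ia; split; [apply: Pi | rewrite Pw // /wait_mode ltn0 eqxx].
- by move=> v; rewrite B.
- by move=> v; rewrite B.
- by move=> k; rewrite min0n.
- by rewrite B.
Qed.

Lemma touring_trip tau r : trip0 <= tau -> touring tau 0 false -> r < 4 * n ->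
  exists dead, touring tau r dead.
Proof.
move=> tau0 H; elim: r => [|r IH] r4; first by exists false.
have [dead Hr] := IH (ltnW r4).
by exists (P' (tt tau r) a == None); apply: touring_step Hr _ => //; apply: ltnW.
Qed.

Lemma dead_forever t k i : P t i = None -> P (t + k) i = None.
Proof.
by move=> Pt; elim: k => [|k IH]; rewrite ?addn0 // addnS (next_dead orderP) // struck_pos_None.
Qed.

Lemma touring_visits tau v : trip0 <= tau -> touring tau 0 false ->
  P (tt tau.+1 0) a != None -> exists2 t, tt tau 0 <= t & P t a = Some v.
Proof.
move=> tau0 H alive.
have [r rn Ev] : exists2 r, r < n & nd (offd n (dir tau) r) = v.
  have lt := off_lt ha v; case: (dir tau); first by exists (off v); rewrite ?nd_off.
  have [o0|o0] := eqVneq (off v) 0.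
    by exists 0; [lia | rewrite /= subn0 ndn -[v in RHS](nd_off ha) o0].
  exists (n - off v); first by lia.
  by rewrite /= -[v in RHS](nd_off ha); congr nd; lia.
have r4 : r < 4 * n by lia.
exists (tt tau r); first by rewrite /tt leq_add2l.
have [[] Hr] := touring_trip tau0 H r4; last by rewrite (tour_pos Hr) (minn_idPl (ltnW rn)) Ev.
(* Death is permanent, so an explorer alive in the next trip was alive in round [r]. *)
case/eqP: alive; rewrite tt_next.
have -> : tt tau (4 * n) = tt tau r + (4 * n - r) by rewrite /tt; lia.
exact/dead_forever/(tour_pos Hr).
Qed.

(* How a survivor stands at the start of a trip after the death of the explorer:
   walking in direction [d] from offset [p] to the home of the explorer, waiting for
   the explorer and about to miss it, or never having met it. *)
Inductive fate := Gathering of bool & nat | Missing | Unaware.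

Definition slot i := (val (ident i)).+1.*2.
Definition unaware f := if f is Unaware then true else false.
Definition gathering f := if f is Gathering _ _ then true else false.

Notation dl i := (off (start i)).

(** * From the death of the explorer to the meeting of the survivors *)

Section Lost.

(* [dd] is the direction of the last trip of the explorer, [first] tells whether it
   was its first one. *)
Variables (dd first : bool).

Section LostTrip.

Variables (tau : nat) (fate_of : 'I_3 -> fate).

(* The agent, if any, that starts to explore in trip [tau]. *)
Definition scout := [pick b | [&& b != a, unaware (fate_of b) & tau == slot b]].
Definition scout_off := if scout is Some b then dl b else n.

(* The scout passes the home of [i] in rounds [scout_out i] and [scout_back i]. *)
Definition scout_out i := dl i - scout_off.
Definition scout_back i := (n - scout_off) + (n - dl i).

(** The scout uses [e] rounds to reach the flag of [a], [e] to return, and one to drop its own flag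
    before leaving again. A passed agent reads [go] one round after it is written and walks in the
    following round, whence the delay of 2. *)
Definition pos_of r i :=
  match fate_of i with
  | Gathering d p => if d then minn n (p + r) else p - r
  | Missing => dl i
  | Unaware =>
    let e := n - dl i in
    if tau == slot i then
      if r <= e then dl i + r else if r <= 2 * e then n - (r - e)
      else minn n (dl i + (r - 2 * e - 1))
    else if (scout_off <= dl i) && (scout_back i + 1 < r) then
      minn n (dl i + (r - scout_back i - 2))
    else dl i
  end.

Definition mode_of r i : mode c n :=
  match fate_of i with
  | Gathering d p => Gather d
  | Missing => if r < 4 * n then Wait (Some (ident a)) false else Gather (dir tau)
  | Unaware =>
    let e := n - dl i in
    if tau == slot i then
      if r <= e then Loop else if r <= 2 * e then Return else Gather true
    else if scout_off <= dl i then
      if scout_back i + 1 < r then Gather true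
      else if scout_out i < r then Wait (omap ident scout) true else Wait None false
    else if (r == 4 * n) && (tau.+1 == slot i) then Loop else Wait None false
  end.

(** The second flag is that of the current scout, until its return; the third is raised by the next
    scout in the last round of the trip. *)
Definition flag_of r v := [|| v == ha,
  (if scout is Some b then (v == start b) && (r <= 2 * (n - dl b)) else false) |
  (r == 4 * n) &&
    [exists i, [&& i != a, unaware (fate_of i), tau.+1 == slot i & v == start i]]].

(** Gathering agents are on the side that makes their walk safe. [Missing] agents were passed in the
    fatal trip before the black hole was reached. [Unaware] ones are right of the black hole, the
    explorer having died in its first, rightward, trip. When [first] holds, agents gathering
    rightwards are already at [n], so they cannot be stopped by the flag of a scout. *)
Definition well_fated i :=
  match fate_of i with
  | Gathering d p =>
    if d then (off vb < p <= n) && (first ==> (p == n)) else p < off vb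
  | Missing =>
    (if odd tau then dl i < off vb else (off vb < dl i) || (dl i == 0)) && (first ==> odd tau)
  | Unaware => [&& first, dd, off vb < dl i & tau <= slot i]
  end.

Record lost r : Prop := Lost {
  lost_explorer : P (tt tau r) a = None;
  lost_fresh : forall k, k < dist dd ->
    mark (bd (tt tau r) (nd (offd n dd k))) = Some dd;
  lost_stale : mark (bd (tt tau r) vb) != Some dd;
  lost_agent : forall i, i != a ->
    P (tt tau r) i = Some (nd (pos_of r i)) /\ md (tt tau r) i = mode_of r i;
  lost_flag : forall v, flag (bd (tt tau r) v) = flag_of r v;
  lost_go : forall i, i != a -> ~~ gathering (fate_of i) -> scout != Some i ->
    go (bd (tt tau r) (start i)) = (scout_off <= dl i) && (scout_back i < r) }.

Hypothesis fates : forall i, i != a -> well_fated i.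

Lemma dl_lt i : dl i < n. Proof. exact: off_lt. Qed.

Lemma scoutP b : scout = Some b <-> [/\ b != a, unaware (fate_of b) & tau = slot b].
Proof.
rewrite /scout; case: pickP => [b' /and3P[ba ub /eqP tb]|none]; last first.
  by split=> // -[ba ub tb]; have := none b; rewrite ba ub tb eqxx.
split=> [[<-] //|[ba' ub' tb']]; congr Some; apply: ident_inj; apply: val_inj.
by move: tb'; rewrite tb /slot; lia.
Qed.

Lemma pos_of_le r i : i != a -> pos_of r i <= n.
Proof.
move=> /fates; rewrite /well_fated /pos_of; have := dl_lt i; have := off_lt ha vb.
case: (fate_of i) => [[] p||] //=; try lia.
by case: ifP => ?; case: ifP => ?; try case: ifP => ?; lia.
Qed.

Lemma pos_of_neq r i : i != a -> pos_of r i != off vb.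
Proof.
move=> /fates; rewrite /well_fated /pos_of; have := dl_lt i; have := off_lt ha vb.
have := off_start_neq i.
case: (fate_of i) => [[] p||] //=; try lia.
by case: ifP => _; case: ifP => ?; try case: ifP => ?; lia.
Qed.

Lemma nd_eq_vb k : k <= n -> (nd k == vb) = (k == off vb).
Proof. by move=> kn; have := off_vb_gt0; rewrite nd_eq //; lia. Qed.

Lemma nd_eq_start k i : k <= n -> (nd k == start i) = (k == dl i) || ((k == n) && (dl i == 0)).
Proof. exact: nd_eq. Qed.

Lemma nd_eq_ha k : k <= n -> (nd k == ha) = (k == 0) || (k == n).
Proof. by move=> kn; rewrite nd_eq // off_ha; lia. Qed.

Section LostStep.

Variable r : nat.
Hypotheses (r4 : r < 4 * n) (H : lost r).
(* Two agents that have gathered at the home of the explorer would pair up. *)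
Hypothesis apart : r = 0 -> forall i j, i != a -> j != a -> i != j ->
  gathering (fate_of i) -> nd (pos_of 0 i) = ha -> nd (pos_of 0 j) != ha.

Let t := tt tau r.

Let at_pos i : i != a -> P' t i = Some (nd (pos_of r i)).
Proof.
move=> ia; apply: struck_pos_safe (lost_agent H ia).1.
by rewrite nd_eq_vb ?pos_of_le // pos_of_neq.
Qed.

Let at_none : P' t a = None.
Proof. exact/struck_pos_None/(lost_explorer H). Qed.

Let board_at i : i != a -> bd' t (nd (pos_of r i)) = bd t (nd (pos_of r i)).
Proof. by move=> ia; rewrite struck_board_safe // nd_eq_vb ?pos_of_le // pos_of_neq. Qed.

Let act_gathering i d p : i != a -> fate_of i = Gathering d p ->
  act t i (nd (pos_of r i)) =
  (Gather d, idfun, if (pos_of r i == 0) || (pos_of r i == n) then Stay else dir_action d).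
Proof.
move=> ia fi; have wi := fates ia; rewrite /well_fated fi in wi.
rewrite performed_tt // -/t (lost_agent H ia).2 /mode_of fi /= board_at // (lost_flag H)
  /flag_of.
rewrite nd_eq_ha ?pos_of_le //.
have -> : (r == 4 * n) = false by lia.
rewrite orbF; case: ifPn => [/orP[hi|]|]; last 1 first.
- by rewrite negb_or => /andP[/negbTE->].
- rewrite hi; case: ifP => // /andP[/eqP r0]; rewrite (present_alone ident_inj (at_pos ia)).
  case/negP; apply/forallP => j; apply/implyP => ji.
  have [->|ja] := eqVneq j a; first by rewrite at_none.
  have := apart r0 ia ja; rewrite eq_sym ji fi at_pos // => /(_ isT isT).
  have -> : nd (pos_of r i) = ha by apply/eqP; rewrite nd_eq_ha ?pos_of_le.
  rewrite r0 in hi *; rewrite (inj_eq (@Some_inj _)); apply.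
  by apply/eqP; rewrite nd_eq_ha ?pos_of_le.
(* A scout forces [first]: an agent gathering rightwards is then at [n], and one gathering leftwards
   is left of the black hole, so neither is at the home of the scout. *)
case: scout (scoutP) => // b /(_ b)[/(_ erefl)[ba ub tb] _] /andP[].
rewrite nd_eq_start ?pos_of_le //.
have := fates ba; rewrite /well_fated; case: (fate_of b) ub => //= _ /and4P[f1 _ bb _].
move: wi; rewrite f1 /pos_of fi; have := dl_lt b; have := off_lt ha vb.
by case: (d) => /=; lia.
Qed.

Definition write_of i :=
  let e := n - dl i in
  if scout == Some i then
    if r < e then set_mark true else if r == e then idfun
    else if r < 2 * e then set_go else if r == 2 * e then drop_flag else idfun
  else if [&& unaware (fate_of i), r.+1 == 4 * n & tau.+1 == slot i] then raise_flag
  else idfun.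

Let flag_at i : i != a -> flag (bd' t (nd (pos_of r i))) =
  [|| pos_of r i == 0, pos_of r i == n |
    if scout is Some b then (pos_of r i == dl b) && (r <= 2 * (n - dl b)) else false].
Proof.
move=> ia; rewrite board_at // (lost_flag H) /flag_of nd_eq_ha ?pos_of_le //.
have -> : (r == 4 * n) = false by rewrite ltn_eqF.
rewrite orbF -orbA; case E: scout => [b|] //; have [ba ub _] := (scoutP b).1 E.
have := fates ba; rewrite /well_fated; case: (fate_of b) ub => //= _ /and4P[_ _ bb _].
by rewrite nd_eq_start ?pos_of_le //; congr [|| _, _ | _ && _]; lia.
Qed.

Let scout_wf b : scout = Some b -> [/\ b != a, fate_of b = Unaware & tau = slot b] /\
  [/\ first, dd & off vb < dl b].
Proof.
move=> /scoutP[ba ub tb]; have := fates ba; rewrite /well_fated.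
by case: (fate_of b) ub => //= _ /and4P[].
Qed.

Let mod_slot i : tau <= slot i -> tau %% trips c = tau.
Proof. by move=> le; rewrite modn_small //; have := ident_lt i; rewrite -/(slot i); lia. Qed.

Lemma act_missing i : i != a -> fate_of i = Missing ->
  exists2 m, act t i (nd (pos_of r i)) = (mode_of r.+1 i, write_of i, m) &
    move_to (nd (pos_of r i)) m = nd (pos_of r.+1 i).
Proof.
move=> ia fi; exists Stay; last by rewrite /pos_of fi.
have wi := fates ia; rewrite /well_fated fi in wi.
(* A scout requires [first] and an even trip, whereas under [first] an agent is [Missing] only in an
   odd trip. *)
have none : scout = None.
  case E: scout => [b|] //; have [[_ _ tb] [f1 _ _]] := scout_wf E.
  by move: wi; rewrite f1 tb /slot odd_double andbF.
have gof : go (bd' t (nd (pos_of r i))) = false.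
  rewrite board_at // /pos_of fi nd_off (lost_go H) ?fi ?none //.
  by rewrite /scout_off none leqNgt dl_lt.
rewrite performed_tt // -/t (lost_agent H ia).2 /mode_of /write_of fi none r4 /= gof odd_trip
  -/(dir tau).
by rewrite in_present // at_none; case: ifP.
Qed.

(** There are three legs, separated by rounds [e] and [2 * e]. Apart from the departure, the scout
    sees a flag only where a leg ends: at [ha], at its own home, then at [ha] again. *)
Lemma act_scout b : scout = Some b ->
  exists2 m, act t b (nd (pos_of r b)) = (mode_of r.+1 b, write_of b, m) &
    move_to (nd (pos_of r b)) m = nd (pos_of r.+1 b).
Proof.
move=> E; have [[ba fb tb] [f1 dd1 bb]] := scout_wf E.
have := flag_at ba; rewrite E; have := dl_lt b.
have tsb : (tau == slot b) = true by rewrite {1}tb eqxx.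
have odd_tau : odd tau = false by rewrite tb /slot odd_double.
rewrite performed_tt // -/t (lost_agent H ba).2.
rewrite /write_of /mode_of /pos_of E fb tsb => dlb.
set e := n - dl b; set w0 := bd' t _ => fl; have e0 : 0 < e by rewrite /e; lia.
have [le_re|lt_er] := leqP r e.
  have rn : r < n by have := off_vb_gt0; lia.
  rewrite /= rn odd_trip odd_tau; have [lt_re|ge_re] := ltnP r e.
    have -> : (0 < r) && flag w0 = false by rewrite fl; branches; lia.
    exists GoRight; first by rewrite eqxx.
    by rewrite move_right addnS.
  have -> : (0 < r) && flag w0 by rewrite fl; branches; lia.
  exists GoLeft; first by rewrite eqxx; branches.
  rewrite move_left; last by lia.
  by branches; congr nd; lia.
have [le_re|lt_er2] := leqP r (2 * e).
  rewrite /=; have [Er|ne] := eqVneq r (2 * e).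
    have -> : flag w0 by rewrite fl; branches; lia.
    exists Stay; first by rewrite eqxx; branches.
    by rewrite /=; branches; congr nd; lia.
  have -> : flag w0 = false by rewrite fl; branches; lia.
  exists GoLeft; first by rewrite eqxx; branches.
  rewrite move_left; last by lia.
  by branches; congr nd; lia.
have [En|ne] := eqVneq (minn n (dl b + (r - 2 * e - 1))) n.
  have fw : flag w0 by rewrite fl; branches; lia.
  have r0 : (r == 0) = false by lia.
  rewrite /= fw r0; exists Stay; first by rewrite eqxx; branches.
  by rewrite /=; branches; congr nd; lia.
have fw : flag w0 = false by rewrite fl; branches; lia.
rewrite /= fw; exists GoRight; first by rewrite eqxx; branches.
by rewrite move_right; branches; congr nd; lia.
Qed.

(** A waiting agent on the way of the scout takes it for the explorer on its outward passage, then
    finds [go] after its return. *)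
Lemma act_passed b i : scout = Some b -> i != a -> i != b -> fate_of i = Unaware ->
  dl b <= dl i ->
  exists2 m, act t i (nd (pos_of r i)) = (mode_of r.+1 i, write_of i, m) &
    move_to (nd (pos_of r i)) m = nd (pos_of r.+1 i).
Proof.
move=> E ia ib fi bi; have [[ba fb tb] [f1 dd1 bb]] := scout_wf E.
have tsb : (tau == slot b) = true by rewrite {1}tb eqxx.
have tsi : (tau == slot i) = false.
  apply/eqP => ti; case/eqP: ib; apply: ident_inj; apply: val_inj.
  by move: ti; rewrite tb /slot; lia.
have tsi' : (tau.+1 == slot i) = false by rewrite tb /slot; lia.
have sob : (scout == Some i) = false by rewrite E (inj_eq (@Some_inj _)) eq_sym (negbTE ib).
have so : scout_off = dl b by rewrite /scout_off E.
have sb : scout_back i = (n - dl b) + (n - dl i) by rewrite /scout_back so.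
have sout : scout_out i = dl i - dl b by rewrite /scout_out so.
have le_slot : tau <= slot b by rewrite tb.
have := flag_at ia; have := dl_lt i; have := dl_lt b.
have seeb : r <= scout_out i ->
    (ident b \in ids t (nd (pos_of r i))) = (r == scout_out i).
  move=> ro; rewrite in_present // at_pos // (inj_eq (@Some_inj _)).
  have := dl_lt i; have := dl_lt b; rewrite sout in ro * => dlb dli.
  have -> : pos_of r i = dl i by rewrite /pos_of fi tsi so bi sb /=; branches.
  have -> : pos_of r b = dl b + r by rewrite /pos_of fb tsb; branches.
  by rewrite nd_off nd_eq_start; lia.
rewrite /write_of sob fi /= tsi' andbF E.
have [r_le|r_gt] := leqP r (scout_back i + 1).
  have pr : pos_of r i = dl i by rewrite /pos_of fi tsi so bi /=; branches.
  have pr' : pos_of r.+1 i = dl i.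
    by rewrite /pos_of fi tsi so bi /=; branches; have := dl_lt i; lia.
  move=> dlb dli _; exists Stay; last by rewrite pr pr'.
  rewrite performed_tt // -/t (lost_agent H ia).2 (mod_slot le_slot) board_at // {2}pr nd_off.
  have gob := lost_go H ia _ _; rewrite fi sob in gob.
  move: (gob isT isT) => {gob}; rewrite so bi /= => gob.
  have r5 : r.+1 < 4 * n by clear - r_le sb dlb dli n3; lia.
  rewrite /mode_of fi tsi so bi ?tsi' ?andbF.
  have [lt_out|ge_out] := leqP r (scout_out i).
    have back_gt : r < scout_back i by clear - lt_out sb sout dlb dli; lia.
    have -> : (scout_back i + 1 < r) = false by clear - r_le; lia.
    have -> : (scout_back i + 1 < r.+1) = false by clear - back_gt; lia.
    rewrite /= gob r5 ltnS.
    have -> : (scout_back i < r) = false by clear - back_gt; lia.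
    have := seeb lt_out; case: pickP => [y /andP[yi /eqP ty]|none] sE.
      have Ey : y = ident b by apply: val_inj; move: ty; rewrite tb /slot /=; clear; lia.
      have le_or : scout_out i <= r by move: yi; rewrite Ey sE => /eqP->.
      by rewrite Ey in yi *; rewrite yi le_or E.
    have -> : (scout_out i <= r) = false.
      move: (none (ident b)); rewrite sE {1}tb /slot eqxx andbT; clear - lt_out; lia.
    by [].
  have -> : (scout_back i + 1 < r) = false by clear - r_le; lia.
  rewrite E /= gob r5.
  have [lt_back|ge_back] := ltnP (scout_back i) r.
    have -> : (scout_back i + 1 < r.+1) by clear - lt_back; lia.
    by [].
  have -> : (scout_back i + 1 < r.+1) = false by clear - ge_back; lia.
  by have -> : scout_out i < r.+1 by clear - ge_out; lia.
rewrite performed_tt // -/t (lost_agent H ia).2 /mode_of /pos_of fi tsi so bi ?tsi' ?andbF r_gt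
  /=.
have -> : scout_back i + 1 < r.+1 by clear - r_gt; lia.
set w0 := bd' t _ => dlb dli fl; clear seeb.
have [En|ne] := eqVneq (minn n (dl i + (r - scout_back i - 2))) n.
  have fw : flag w0 by rewrite fl; clear - En dlb dli; lia.
  have r0 : (r == 0) = false by clear - r_gt; lia.
  rewrite fw r0; exists Stay => //=.
  by congr nd; clear - En r_gt; lia.
have fw : flag w0 = false by rewrite fl; clear - ne r_gt sb bi dlb dli bb; lia.
rewrite fw; exists GoRight => //.
by rewrite move_right; congr nd; clear - ne r_gt; lia.
Qed.

Lemma act_idle i : i != a -> fate_of i = Unaware -> tau != slot i -> dl i < scout_off ->
  exists2 m, act t i (nd (pos_of r i)) = (mode_of r.+1 i, write_of i, m) &
    move_to (nd (pos_of r i)) m = nd (pos_of r.+1 i).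
Proof.
move=> ia fi /negbTE tsi lti; exists Stay; last by rewrite /pos_of fi tsi leqNgt lti.
have := fates ia; rewrite /well_fated fi => /and4P[f1 _ bi ti].
have sob : (scout == Some i) = false.
  by apply/eqP => E; move: lti; rewrite /scout_off E ltnn.
have pr : pos_of r i = dl i by rewrite /pos_of fi tsi leqNgt lti.
have gof := lost_go H ia _ _; rewrite fi sob in gof.
move: (gof isT isT) => {gof}; rewrite leqNgt lti /= => gof.
rewrite performed_tt // -/t (lost_agent H ia).2 (mod_slot ti) board_at // {2}pr nd_off.
have r_neq : (r == 4 * n) = false by rewrite ltn_eqF.
rewrite /mode_of /write_of sob fi tsi leqNgt lti r_neq /= gof; case: pickP =>
  [y /andP[/(presentP _) [j Ey Pj] /eqP ty]|_].
  (* Were such a [j] present, it would be the scout, which keeps to offsets at least [dl j > dl i]: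
     gathering agents are elsewhere, and [Missing] ones occur only in odd trips. *)
  exfalso; have tj : tau = slot j by rewrite ty Ey.
  have ja : j != a by apply/eqP => ja; move: Pj; rewrite ja at_none.
  move: Pj; rewrite at_pos // => -[/eqP]; rewrite pr nd_off nd_eq_start ?pos_of_le //.
  have := fates ja; have dlj := dl_lt j; have dli := dl_lt i; have b0 := off_vb_gt0.
  rewrite /well_fated; case fj: (fate_of j) => [d p||].
  - by rewrite f1 /pos_of fj; case: (d) => /=; lia.
  - by rewrite f1 tj /slot odd_double andbF.
  move=> _; have E : scout = Some j by apply/scoutP; rewrite fj.
  have tsj : (tau == slot j) by apply/eqP.
  by move: lti; rewrite /scout_off E /pos_of fj tsj => lti; branches; lia.
have -> : (tau == (val (ident i)).*2.+1) = (tau.+1 == slot i) by rewrite /slot; lia.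
have [r5|r5] := ltnP r.+1 (4 * n); first by have -> : (r.+1 == 4 * n) = false by lia.
have -> : (r.+1 == 4 * n) by lia.
by rewrite /=; case: ifP.
Qed.

Lemma act_lost i : i != a ->
  exists2 m, act t i (nd (pos_of r i)) = (mode_of r.+1 i, write_of i, m) &
    move_to (nd (pos_of r i)) m = nd (pos_of r.+1 i).
Proof.
move=> ia; case fi: (fate_of i) => [d p||]; last 1 first.
- have [ti|ti] := eqVneq tau (slot i); first by apply/act_scout/scoutP; rewrite fi.
  have [|lti] := leqP scout_off (dl i); last exact: act_idle.
  rewrite /scout_off; case E: scout => [b|]; last by rewrite leqNgt dl_lt.
  move=> bi; apply: (act_passed E) => //; apply/eqP => ib.
  by have [[_ _ tb] _] := scout_wf E; rewrite -ib in tb; rewrite tb eqxx in ti.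
- have sob : (scout == Some i) = false.
    by apply/eqP => /scoutP[]; rewrite fi.
  have pn := pos_of_le r ia; have := fates ia; rewrite /well_fated fi => wi.
  rewrite (act_gathering ia fi) /mode_of /write_of sob fi /=.
  exists (if (pos_of r i == 0) || (pos_of r i == n) then Stay else dir_action d) => //.
  have bn := off_lt ha vb; move: pn; rewrite /pos_of fi; case: d {fi} wi => wi pn.
    case: ifPn => [/orP[/eqP p0|/eqP pn']|]; try by congr nd; lia.
    by rewrite negb_or => ?; rewrite move_right; congr nd; lia.
  case: ifPn => [/orP[/eqP p0|/eqP pn']|]; try by rewrite /=; congr nd; lia.
  rewrite negb_or => ?; rewrite [dir_action _]/= move_left; last by lia.
  by congr nd; lia.
- exact: act_missing.
Qed.

Let next_lost i : i != a ->
  P t.+1 i = Some (nd (pos_of r.+1 i)) /\ md t.+1 i = mode_of r.+1 i.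
Proof.
move=> ia; have [-> ->] := next_agent n3 orderP (at_pos ia).
by have [m -> ->] := act_lost ia.
Qed.

Let writeE i v : P' t i = Some v -> i != a /\ (act t i v).1.2 = write_of i.
Proof.
have [->|ia] := eqVneq i a; first by rewrite at_none.
by rewrite at_pos // => -[<-]; have [m -> _] := act_lost ia.
Qed.

Let flag_vb : flag (bd t vb) = false.
Proof.
rewrite (lost_flag H) /flag_of.
have -> : (r == 4 * n) = false by lia.
have h i : (vb == start i) = false by rewrite eq_sym (negbTE (start_safe i)).
by rewrite h; case: scout => [b|] //; rewrite h.
Qed.

(** The black hole bears no flag, so an erasure loses none. *)
Let flag_blank v : flag (bd' t v) = flag_of r v.
Proof.
rewrite -(lost_flag H); have [->|/struck_board_safe-> //] := eqVneq v vb.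
by have [->|->] := struck_board_cases ident start vb active erase order t vb; rewrite ?flag_vb.
Qed.

Let slot_inj i j : slot i = slot j -> i = j.
Proof. by move=> E; apply/ident_inj/val_inj; move: E; rewrite /slot /=; lia. Qed.

Let next_flag v : flag (bd t.+1 v) = flag_of r.+1 v.
Proof.
have r0 : (r == 4 * n) = false by rewrite ltn_eqF.
case: (boolP ((r.+1 == 4 * n) &&
    [exists i, [&& i != a, unaware (fate_of i), tau.+1 == slot i & v == start i]])) =>
      [last|nlast].
  rewrite /flag_of last !orbT; have /andP[r5 /existsP[i /and4P[ia ui ti /eqP vi]]] := last.
  have none : scout = None.
    by case E: scout => [b|] //; have [[_ _ tb] _] := scout_wf E; move: ti; rewrite tb /slot;
      lia.
  have Pi : P' t i = Some v.
    rewrite at_pos // vi -[in RHS](nd_off ha (start i)); congr (Some (nd _)).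
    rewrite /pos_of /scout_off none; case: (fate_of i) ui => // _.
    have -> : (tau == slot i) = false by move: ti; rewrite /slot; lia.
    by rewrite leqNgt dl_lt.
  apply: (board_set n3 orderP (phi := flag) Pi) => [w|j ji Pj w].
    by have [_ ->] := writeE Pi; rewrite /write_of none ui r5 ti.
  have [ja ->] := writeE Pj; rewrite /write_of none; case: ifP => // /and3P[_ _ /eqP tj].
  by case/eqP: ji; apply: slot_inj; rewrite -tj (eqP ti).
case: (boolP (if scout is Some b then (v == start b) && (r == 2 * (n - dl b)) else false)) =>
  [|nscout].
  case E: scout => [b|] // /andP[/eqP vb' rb]; have [[ba fb tb] [_ _ bb]] := scout_wf E.
  have dlb := dl_lt b; have tsb : (tau == slot b) by apply/eqP.
  have Pb : P' t b = Some v.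
    rewrite at_pos // vb' -[in RHS](nd_off ha (start b)); congr (Some (nd _)).
    by rewrite /pos_of fb tsb; branches; lia.
  transitivity false; last first.
    rewrite /flag_of E (negbTE nlast) vb' eqxx orbF.
    have -> : (start b == ha) = false by rewrite -(nd_off ha (start b)) nd_eq_ha; lia.
    by lia.
  apply: (board_set n3 orderP (phi := flag) Pb) => [w|j jb Pj w].
    by have [_ ->] := writeE Pb; rewrite /write_of E eqxx; branches.
  have [ja ->] := writeE Pj; rewrite /write_of E (inj_eq (@Some_inj _)) eq_sym (negbTE jb).
  by case: ifP => // /and3P[_ /eqP r5 _]; exfalso; lia.
rewrite (board_inv n3 orderP (phi := flag)) ?flag_blank.
  rewrite /flag_of (negbTE nlast) r0 /=; congr (_ || (_ || _)).
  move: nscout; case: scout => // b; case: (v == start b) => //=; lia.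
move=> i Pi w; have [ia ->] := writeE Pi; rewrite /write_of.
case: ifP => [/eqP E|_].
  have [[_ fi ti] [_ _ bi]] := scout_wf E; move: nscout; rewrite E => nscout.
  case: ifP => // ?; case: ifP => // ?; case: ifP => // ?; case: ifP => // r2.
  case/negP: nscout; rewrite r2 andbT; move: Pi; rewrite at_pos // => -[<-].
  rewrite -[X in _ == X](nd_off ha); apply/eqP; congr nd; have := dl_lt i.
  have tsi : (tau == slot i) by apply/eqP.
  by rewrite /pos_of fi tsi; branches; lia.
case: ifP => // /and3P[ui r5 ti]; case/negP: nlast; rewrite r5; apply/existsP; exists i.
rewrite ia ui ti; move: Pi; rewrite at_pos // => -[<-].
have none : scout = None.
  by case E: scout => [b|] //; have [[_ _ tb] _] := scout_wf E; move: ti; rewrite tb /slot; lia.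
rewrite -[X in _ == X](nd_off ha); apply/eqP; congr nd.
rewrite /pos_of /scout_off none; case: (fate_of i) ui => // _.
have -> : (tau == slot i) = false by move: ti; rewrite /slot; lia.
by rewrite leqNgt dl_lt.
Qed.

Let next_go i : i != a -> ~~ gathering (fate_of i) -> scout != Some i ->
  go (bd t.+1 (start i)) = (scout_off <= dl i) && (scout_back i < r.+1).
Proof.
move=> ia gi si; have dli := dl_lt i.
have goE : go (bd' t (start i)) = (scout_off <= dl i) && (scout_back i < r).
  by rewrite struck_board_start (lost_go H).
have goes b w : scout = Some b -> r = scout_back i -> scout_off <= dl i -> go (write_of b w).
  move=> E Er so; rewrite /write_of E eqxx; move: Er so; rewrite /scout_back /scout_off E =>
    Er so.
  by have := dl_lt b; branches.
case: (boolP ((scout_off <= dl i) && (r == scout_back i))) => [/andP[so /eqP Er]|nback].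
  rewrite so Er ltnSn; case E: scout => [b|]; last first.
    by move: so; rewrite /scout_off E leqNgt dli.
  have [[ba fb tb] [_ _ bb]] := scout_wf E; have dlb := dl_lt b.
  have tsb : (tau == slot b) by apply/eqP.
  have Pb : P' t b = Some (start i).
    rewrite at_pos // -[in RHS](nd_off ha (start i)); congr (Some (nd _)).
    move: Er so; rewrite /scout_back /scout_off E => Er so.
    by rewrite /pos_of fb tsb; branches; lia.
  apply: (board_set n3 orderP (phi := go) Pb) => [w|j jb Pj w].
    by have [_ ->] := writeE Pb; apply: goes.
  have [ja ->] := writeE Pj; rewrite /write_of E (inj_eq (@Some_inj _)) eq_sym (negbTE jb).
  by case: ifP.
rewrite (board_inv n3 orderP (phi := go)) ?goE.
  by move: nback; case: (scout_off <= dl i) => //=; lia.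
move=> j Pj w; have [ja ->] := writeE Pj; rewrite /write_of.
case: ifP => [/eqP E|_]; last by case: ifP.
have [[_ fj tj] [_ _ bj]] := scout_wf E; have dlj := dl_lt j.
have tsj : (tau == slot j) by apply/eqP.
move: nback; rewrite /scout_back /scout_off E.
move: Pj; rewrite at_pos // => -[/eqP]; rewrite nd_eq_start ?pos_of_le // /pos_of fj tsj.
by branches => ? ?; exfalso; lia.
Qed.

(** Marks are written only by a scout on its outward leg. These nodes lie beyond the black hole, so
    the fresh and stale marks used later are untouched. *)
Let next_mark v : (forall b, scout = Some b -> forall k, dl b <= k -> k < n -> v != nd k) ->
  mark (bd t.+1 v) = mark (bd' t v).
Proof.
move=> far; apply: (board_inv n3 orderP (phi := mark)) => i Pi w.
have [ia ->] := writeE Pi; rewrite /write_of.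
case: ifP => [/eqP E|_]; last by case: ifP.
have [[_ fi ti] [_ _ bi]] := scout_wf E; have dli := dl_lt i.
have tsi : (tau == slot i) by apply/eqP.
case: ifP => re; last by branches.
have lt_n : dl i + r < n by lia.
move: Pi; rewrite at_pos // => -[] Ev; have /eqP := far i E _ (leq_addr r _) lt_n; case.
by rewrite -Ev; congr nd; rewrite /pos_of fi tsi; branches; lia.
Qed.

Lemma lost_step : lost r.+1.
Proof.
have b0 := off_vb_gt0; have bn := off_lt ha vb.
split; rewrite /tt ?addnS -/(tt tau r) -/t.
- exact: (next_dead orderP at_none).
- move=> k kd; have := dist_bounds dd => dn.
  have kn : k <= n by lia.
  rewrite next_mark; last first.
    move=> b E l bl ln; have [_ [_ dd1 bb]] := scout_wf E.
    by apply/eqP => /nd_inj; move: kd; rewrite /dist dd1 /=; lia.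
  by rewrite struck_board_safe ?nd_offd_vb ?(lost_fresh H) //; lia.
- rewrite next_mark; last first.
    move=> b E l bl ln; have [_ [_ dd1 bb]] := scout_wf E.
    by rewrite eq_sym nd_eq_vb; lia.
  by have [->|->] := struck_board_cases ident start vb active erase order t vb;
    rewrite ?(lost_stale H).
- exact: next_lost.
- exact: next_flag.
- exact: next_go.
Qed.

End LostStep.
Lemma lost_trip : lost 0 ->
  (forall i j, i != a -> j != a -> i != j -> gathering (fate_of i) ->
     nd (pos_of 0 i) = ha -> nd (pos_of 0 j) != ha) ->
  lost (4 * n).
Proof.
move=> H0 apart; have: 4 * n <= 4 * n by [].
elim: {1 3}(4 * n) => // r IH r4; apply: lost_step (IH (ltnW r4)) _ => // _.
Qed.

(** A trip is long enough for any gathering agent to reach [ha], represented by [n] or 0 according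
    to its direction. *)
Definition next_fate i :=
  match fate_of i with
  | Gathering d p => Gathering d (offd n (~~ d) 0)
  | Missing => Gathering (dir tau) (if dl i == 0 then offd n (~~ dir tau) 0 else dl i)
  | Unaware =>
    if (tau == slot i) || (scout_off <= dl i) then Gathering true n else Unaware
  end.

Lemma next_well_fated i : i != a ->
  match next_fate i with
  | Gathering d p =>
    if d then (off vb < p <= n) && (first ==> (p == n)) else p < off vb
  | Missing => false
  | Unaware => [&& first, dd, off vb < dl i & tau.+1 <= slot i]
  end.
Proof.
move=> /fates; have bn := off_lt ha vb; have b0 := off_vb_gt0; have dli := dl_lt i.
rewrite /well_fated /next_fate; case: (fate_of i) => [[] p||] /=; try lia.
  rewrite /dir; case: (odd tau); rewrite /= ?implybT ?implybF ?andbT.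
    by case: eqP; lia.
  by move=> /andP[h /negbTE->]; move: h; case: eqP; lia.
move=> /and4P[f1 d1 bi ti]; case: ifPn => [_|]; first by rewrite f1; lia.
by rewrite f1 d1 bi /=; lia.
Qed.

End LostTrip.

Lemma lost_next tau fate_of : (forall i, i != a -> well_fated tau fate_of i) ->
  lost tau fate_of (4 * n) -> lost tau.+1 (next_fate tau fate_of) 0.
Proof.
move=> wf H; have b0 := off_vb_gt0; have bn := off_lt ha vb.
have n40 : (0 == 4 * n) = false by lia.
(* Slots are even: if [tau.+1] is a slot, trip [tau] has no scout and the unaware agent of that slot
   has learnt nothing. *)
have sc : scout tau.+1 (next_fate tau fate_of) =
    [pick b | [&& b != a, unaware (fate_of b) & tau.+1 == slot b]].
  apply: eq_pick => b /=; case: (boolP (b == a)) => //= ba.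
  case tb: (tau.+1 == slot b); rewrite ?andbF // !andbT /next_fate.
  case fb: (fate_of b) => //=.
  have -> : (tau == slot b) = false by move: tb; rewrite /slot; lia.
  suff none : scout tau fate_of = None by rewrite /scout_off none leqNgt dl_lt.
  case E: scout => [j|] //; have [_ _ tj] := (scoutP tau fate_of j).1 E.
  by move: tb; rewrite tj /slot; lia.
split; rewrite ?tt_next; try by case: H.
- move=> i ia; have [-> ->] := lost_agent H ia.
  have dli := dl_lt i; have := wf i ia.
  rewrite /well_fated /pos_of /mode_of /next_fate; case fi: (fate_of i) => [d p||].
  + by move=> w; split=> //; congr (Some (nd _)); case: (d) w => /= w; lia.
  + rewrite ltnn => w; split=> //; case: eqP => [d0|_]; last first.
      by congr (Some (nd _)); case: dir => /=; lia.
    by rewrite d0 nd0; case: dir => /=; rewrite ?subn0 ?addn0 ?minnn ?ndn.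
  move=> /and4P[_ _ bi ti]; case: (eqVneq tau (slot i)) => [tsi|tsi] /=.
    by split; [congr (Some (nd _)); branches; lia | branches].
  have [so|so] := leqP (scout_off tau fate_of) (dl i).
    have back : scout_back tau fate_of i + 1 < 4 * n by rewrite /scout_back; lia.
    rewrite back /=; split=> //; congr (Some (nd _)).
    by rewrite /scout_back; lia.
  rewrite n40 eqxx /= !andbF /=.
  case: (eqVneq tau.+1 (slot i)) => _; rewrite /= ?addn0 ?if_same //.
- move=> v; rewrite (lost_flag H) /flag_of n40 eqxx sc /=; congr (_ || _).
  have -> : (if scout tau fate_of is Some b then (v == start b) && (4 * n <= 2 * (n - dl b))
      else false) = false.
    by case: scout => // b; have := dl_lt b; lia.
  rewrite orbF /=; apply/existsP/idP => [[i /and4P[ia ui ti vi]]|].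
    case: pickP => [b /and3P[_ _ tb]|/(_ i)]; last by rewrite ia ui ti.
    have -> : b = i by apply/ident_inj/val_inj; move: ti tb; rewrite /slot; lia.
    by rewrite vi.
  by case: pickP => // b /and3P[ba ub tb] /andP[vb' _]; exists b; rewrite ba ub tb.
- move=> i ia; rewrite {1}/next_fate ltn0 andbF.
  case fi: (fate_of i) => [d p||] //=; case: ifPn => // + _ _.
  rewrite negb_or => /andP[ti so]; rewrite (lost_go H) ?fi ?(negbTE so) //.
  by apply/eqP => /scoutP[_ _ tsi]; rewrite tsi eqxx in ti.
Qed.

(** Variant for the meeting: each positive weight decreases at every trip, and it vanishes once the
    agent has gathered at [ha]. *)
Definition weight tau (f : 'I_3 -> fate) i :=
  match f i with
  | Gathering d p => (0 < p < n) : nat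
  | Missing => 2
  | Unaware => 2 + (slot i - tau)
  end.

Lemma third i j k : i != a -> j != a -> i != j -> k != a -> (k == i) || (k == j).
Proof.
move: (ltn_ord a) (ltn_ord i) (ltn_ord j) (ltn_ord k).
by rewrite -!(inj_eq val_inj) /=; lia.
Qed.

(** The disjunction excludes a premature pairing, in which a gathering agent at [ha] takes for its
    partner an agent still [Missing] there. Just after the death gathering agents are away from
    [ha]; one trip later nobody is [Missing]. *)
Lemma lost_meet tau f : lost tau f 0 -> (forall i, i != a -> well_fated tau f i) ->
  (forall i, i != a -> f i <> Missing) \/
  (forall i d p, i != a -> f i = Gathering d p -> 0 < p < n) ->
  exists tau' f', [/\ lost tau' f' 0, forall i, i != a -> P (tt tau' 0) i = Some ha &
    forall i, i != a -> exists d, md (tt tau' 0) i = Gather d].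
Proof.
have [m] := ubnP (\sum_(i | i != a) weight tau f i).
elim: m tau f => // m IH tau f lm H wf sync.
have bn := off_lt ha vb; have b0 := off_vb_gt0.
have home0 i : i != a -> nd (pos_of tau f 0 i) = ha -> f i <> Missing -> weight tau f i = 0.
  move=> ia /eqP; rewrite nd_eq_ha ?pos_of_le //; have := wf i ia; have dli := dl_lt i.
  rewrite /well_fated /pos_of /weight; case: (f i) => [d p||] //.
    by case: (d) => /= w h _; lia.
  by move=> /and4P[_ _ bi _]; branches; lia.
have [/eqP all0|] := boolP (\sum_(i | i != a) weight tau f i == 0).
  have w0 i : i != a -> weight tau f i = 0.
    by move=> ia; move/eqP: all0; rewrite sum_nat_eq0 => /forallP/(_ i); rewrite ia => /eqP.
  exists tau, f; split=> // i ia; have [Pi Mi] := lost_agent H ia.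
    rewrite Pi; congr Some; apply/eqP; rewrite nd_eq_ha ?pos_of_le //.
    have := w0 i ia; have := wf i ia; rewrite /weight /well_fated /pos_of.
    by case: (f i) => [[] p||] //=; lia.
  by have := w0 i ia; rewrite Mi /weight /mode_of; case: (f i) => // d p _; exists d.
rewrite sum_nat_eq0 negb_forall => /existsP[k]; rewrite negb_imply => /andP[ka wk].
have apart i j : i != a -> j != a -> i != j -> gathering (f i) ->
    nd (pos_of tau f 0 i) = ha -> nd (pos_of tau f 0 j) != ha.
  move=> ia ja ij gi hi; apply/eqP => hj.
  case: sync => [nm|sync]; last first.
    case fi: (f i) gi => [d p||] // _; have := sync i d p ia fi.
    move/eqP: hi; rewrite nd_eq_ha ?pos_of_le // /pos_of fi.
    by case: (d) => /=; lia.
  have wi := home0 i ia hi (nm i ia); have wj := home0 j ja hj (nm j ja).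
  by case/orP: (third ia ja ij ka) => /eqP E; move: wk; rewrite E ?wi ?wj.
have {}H := lost_next wf (lost_trip wf H apart).
apply: IH H _ _.
- have le i : i != a ->
      weight tau.+1 (next_fate tau f) i <= weight tau f i - (0 < weight tau f i).
    move=> ia; have := wf i ia; have dli := dl_lt i.
    rewrite /weight /well_fated /next_fate; case: (f i) => [d p||].
    + by case: (d) => /=; lia.
    + by move=> _; case: eqP => _; case: (dir tau) => /=; lia.
    by move=> /and4P[_ _ _ ti]; case: ifPn => [_|/norP[/eqP ne _]]; lia.
  move: lm; rewrite (bigD1 k) //= => lm; rewrite (bigD1 k) //=.
  have lek : weight tau.+1 (next_fate tau f) k < weight tau f k.
    by have := le k ka; rewrite lt0n wk; move: wk; clear; lia.
  suff : \sum_(i | (i != a) && (i != k)) weight tau.+1 (next_fate tau f) i <=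
    \sum_(i | (i != a) && (i != k)) weight tau f i
    by move=> les; rewrite ltnS in lm; apply: leq_trans _ lm; rewrite -addSn leq_add.
  by apply: leq_sum => i /andP[ia _]; apply: leq_trans (le i ia) (leq_subr _ _).
- move=> i ia; have := next_well_fated wf ia; rewrite /well_fated.
  by case: (next_fate tau f i).
- by left=> i ia E; have := next_well_fated wf ia; rewrite E.
Qed.

End Lost.

Lemma touring_end tau : trip0 <= tau -> touring tau 0 false ->
  touring tau.+1 0 false \/ exists fate_of,
    [/\ lost (dir tau) tau.+1 fate_of 0,
      forall i, i != a -> well_fated (dir tau) (tau == trip0) tau.+1 fate_of i &
      forall i d p, i != a -> fate_of i = Gathering d p -> 0 < p < n].
Proof.
move=> tau0 H; have r4 : (4 * n).-1 < 4 * n by lia.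
have [dead Hr] := touring_trip tau0 H r4.
have /(_ _)[|] := touring_last tau0 r4 Hr; first by rewrite prednK //; lia.
rewrite !prednK ?[in X in X -> _]tt_next; last by lia.
have -> : (tt tau (4 * n).-1).+1 = tt tau.+1 0 by rewrite /tt; lia.
set dead' := P' _ a == None; case: dead' => Pa Ma Po Fl [Fr St]; last first.
  left; split=> //=.
  - by rewrite Pa min0n offd0.
  - move=> i ia; have [-> ->] := Po i ia; split=> //.
    have dli := off_lt ha (start i).
    have vn : visit (dir tau) i < 4 * n by rewrite /visit; case: ifP; lia.
    rewrite /wait_mode vn ltn0 /= !andbF /=.
    by have -> : (tau.+1 == trip0) = false by lia.
  - by move=> v; have [] := Fl v.
  - by move=> v; have [] := Fl v.
  - by move=> k; rewrite min0n.
right; have b0 := off_vb_gt0; have bn := off_lt ha vb.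
pose saw i := visit (dir tau) i < dist (dir tau).
(* Agents passed before the fatal round notice the death only in the next trip. The others notice it
   now, unless this was the first trip and they do not know that an explorer exists. *)
pose f i := if saw i then Missing else
  if tau == trip0 then Unaware else Gathering (dir tau) (off (start i)).
have slot_next i : i != a -> tau == trip0 -> tau.+1 < slot i.
  by move=> /a_min lt /eqP->; rewrite /trip0 /slot; lia.
have sc : scout tau.+1 f = None.
  rewrite /scout; case: pickP => // b /and3P[ba + /eqP tb].
  by rewrite /f; case: ifP => // _; case: ifP => // /(slot_next b ba); rewrite tb ltnn.
have sawE i : i != a -> saw i = if dir tau then off (start i) < off vb
    else (off vb < off (start i)) || (off (start i) == 0).
  move=> _; have := off_start_neq i; have := off_lt ha (start i).
  by rewrite /saw /visit /dist /offd; case: (dir tau) => /=; case: (off (start i) =P 0) => /=;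
    lia.
exists f; split.
- split=> //.
  + move=> i ia; have [-> ->] := Po i ia; rewrite /pos_of /mode_of.
    rewrite (_ : f i = if saw i then Missing else if tau == trip0 then Unaware
      else Gathering (dir tau) (off (start i))) // /wait_mode -/(saw i).
    have dli := off_lt ha (start i).
    have vn : visit (dir tau) i < 4 * n by rewrite /visit; case: ifP; lia.
    have n4 : 0 < 4 * n by lia.
    rewrite vn /=; case: (saw i); rewrite /= ?andbF ?n4 ?nd_off //.
    rewrite andbT; case t0: (tau == trip0) => /=; last first.
      split=> //; congr Some; rewrite -[LHS](nd_off ha); congr nd.
      by case: (dir tau) => /=; lia.
    have -> : (tau.+1 == slot i) = false by have := slot_next i ia t0; lia.
    have -> : (0 == 4 * n) = false by lia.
    by rewrite /scout_off sc leqNgt dli /= nd_off.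
  + move=> v; have [-> _] := Fl v; rewrite /flag_of sc.
    have -> : (0 == 4 * n) = false by lia.
    by rewrite orbF.
  + by move=> i ia _ _; have [_ ->] := Fl (start i); rewrite ltn0 andbF.
- move=> i ia; rewrite /well_fated /f; have := sawE i ia; have := off_start_neq i.
  have dli := off_lt ha (start i).
  case: (saw i).
    move=> _; rewrite /dir /=; case ot: (odd tau) => /= <- //=; last by rewrite implybT.
    by rewrite implybF; apply/eqP => t0; move: ot; rewrite t0 /trip0 odd_double.
  case t0: (tau == trip0) => ne h.
    have dt : dir tau = true by rewrite (eqP t0) /dir /trip0 odd_double.
    by rewrite dt /=; move: h; rewrite dt; have := slot_next i ia t0; lia.
  by move: h; case: (dir tau) => /=; lia.
- move=> i d p ia; rewrite /f; case: ifPn => // ns; case: ifP => // _ [_ <-].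
  have dli := off_lt ha (start i); move: ns; rewrite /saw /visit /dist /offd.
  by case: (dir tau) => /=; case: (off (start i) =P 0) => /=; lia.
Qed.

Lemma dead_or_touring tau : trip0 <= tau ->
  touring tau 0 false \/ exists dd tau' f,
    lost dd tau' f 0 /\ forall i, i != a -> P (tt tau' 0) i = Some ha /\
      exists d, md (tt tau' 0) i = Gather d.
Proof.
elim: tau => [|tau IH] tau0; first by rewrite /trip0 in tau0.
move: tau0; rewrite leq_eqVlt => /orP[/eqP<-|]; first by left; apply: touring_start.
rewrite ltnS => tau0; case: (IH tau0) => [H|]; last by right.
have [|[f [Hl wf sync]]] := touring_end tau0 H; first by left.
right; have [tau' [f' [Hl' Pi Mi]]] := lost_meet Hl wf (or_intror sync).
exists (dir tau), tau', f'; split=> // i ia.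
by split; [apply: Pi | apply: Mi].
Qed.

(** * Two agents probing towards the black hole *)

Section Pair.

Variables (dd : bool) (b c' : 'I_3).
Hypotheses (ba : b != a) (ca : c' != a) (bc : b != c').
Hypothesis b_lt : val (ident b) < val (ident c').

Record marked t : Prop := Marked {
  marked_dead : P t a = None;
  marked_fresh : forall k, k < dist dd -> mark (bd t (nd (offd n dd k))) = Some dd;
  marked_stale : mark (bd t vb) != Some dd }.

(** Without writes, boards change only by erasure, which blanks the black hole and so keeps it
    stale. *)
Lemma marked_next t : marked t ->
  (forall i v, i != a -> P' t i = Some v -> (act t i v).1.2 = idfun) -> marked t.+1.
Proof.
move=> [da fr st] id_act.
have keep v : bd t.+1 v = bd' t v.
  apply: (board_inv n3 orderP (phi := id)) => i Pi w.
  by have [ia|ia] := eqVneq i a; [rewrite ia (struck_pos_None da) in Pi | rewrite id_act].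
split; first by rewrite (next_dead orderP) // struck_pos_None.
- move=> k kd; rewrite keep; have := dist_bounds dd => db.
  by rewrite struck_board_safe ?fr // nd_offd_vb; lia.
- by rewrite keep; have [->|->] := struck_board_cases ident start vb active erase order t vb.
Qed.

Lemma nd_offd_safe j : j < n -> j != dist dd -> nd (offd n dd j) != vb.
Proof. by move=> jn jd; rewrite nd_offd_vb // ltnW. Qed.

Record paired t j : Prop := Paired {
  paired_marked : marked t;
  paired_b : P t b = Some (nd (offd n dd j));
  paired_c : P t c' = Some (nd (offd n dd j));
  paired_mb : md t b = Advance true dd;
  paired_mc : md t c' = Advance false dd }.

(** The mark at [ha] is fresh, so both agents read the direction [dd]; the smaller identifier elects
    the probing agent. *)
Lemma pair_start tau f : lost dd tau f 0 ->
  (forall i, i != a -> P (tt tau 0) i = Some ha /\ exists d, md (tt tau 0) i = Gather d) ->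
  paired (tt tau 0).+1 0.
Proof.
move=> H met; set t := tt tau 0.
have da : P t a = None := lost_explorer H.
have at_ha i : i != a -> P' t i = Some ha by move=> ia;
  apply: struck_pos_safe (start_safe a) (met i ia).1.
have idsE y : (y \in ids t ha) = (y == ident b) || (y == ident c').
  apply/presentP/orP => [[i -> Pi]|[/eqP->|/eqP->]]; last 2 first.
  - by exists b; rewrite ?at_ha.
  - by exists c'; rewrite ?at_ha.
  have ia : i != a by apply/eqP => ia; rewrite ia (struck_pos_None da) in Pi.
  by case/orP: (third ba ca bc ia) => /eqP->; [left | right].
have actE i : i != a -> act t i ha = (Advance (i == b) dd, idfun, Stay).
  move=> ia; have [_ [d md_i]] := met i ia.
  have n4 : 0 < 4 * n by lia.
  rewrite performed_tt // -/t md_i /= struck_board_start (lost_flag H) /flag_of eqxx /=.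
  have -> : mark (bd t ha) = Some dd.
    by rewrite -(offd0 ha dd); apply: (lost_fresh H); case/andP: (dist_bounds dd).
  have -> : ids t ha != [set ident i].
    apply/eqP => /setP E; have := E (ident b); have := E (ident c').
    rewrite !inE !idsE !eqxx orbT /= !(inj_eq ident_inj) => /esym/eqP<- /esym.
    by rewrite (negbTE bc).
  congr (Advance _ _, _, _).
  apply/forallP/eqP => [all_le|-> y].
    case/orP: (third ba ca bc ia) => /eqP // ic; have := all_le (ident b).
    by rewrite idsE eqxx ic /= leqNgt b_lt.
  by rewrite idsE; apply/implyP => /orP[] /eqP-> //; apply: ltnW.
have next i : i != a -> P t.+1 i = Some ha /\ md t.+1 i = Advance (i == b) dd.
  by move=> ia; have [-> ->] := next_agent n3 orderP (at_ha i ia); rewrite actE.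
have [Pb Mb] := next b ba; have [Pc Mc] := next c' ca.
split; rewrite ?offd0 ?Pb ?Pc ?Mb ?Mc ?eqxx 1?eq_sym ?(negbTE bc) //.
apply: marked_next; first by case: H.
by move=> i v ia; rewrite at_ha // => -[<-]; rewrite actE.
Qed.

Lemma act_advance t i v e d : md t i = Advance e d ->
  act t i v = (Probe e d, idfun, if e then dir_action d else Stay).
Proof. by rewrite /performed => ->. Qed.

Lemma pair_probe t j : j < dist dd -> paired t j ->
  [/\ marked t.+1, P t.+1 b = Some (nd (offd n dd j.+1)), P t.+1 c' = Some (nd (offd n dd j)) &
    md t.+1 b = Probe true dd /\ md t.+1 c' = Probe false dd].
Proof.
move=> jd [mk Pb Pc Mb Mc]; have db := dist_bounds dd.
have safe : nd (offd n dd j) != vb by apply: nd_offd_safe; lia.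
have [Pb' Mb'] := next_agent n3 orderP (struck_pos_safe safe Pb).
have [Pc' Mc'] := next_agent n3 orderP (struck_pos_safe safe Pc).
rewrite Pb' Mb' Pc' Mc' (act_advance _ Mb) (act_advance _ Mc) /= move_dir; last by lia.
split=> //; apply: marked_next => // i v ia _.
by case/orP: (third ba ca bc ia) => /eqP->; rewrite (act_advance _ Mb, act_advance _ Mc).
Qed.

(** The three rounds are the probe, the return on reading a fresh mark, and the joint advance. *)
Lemma pair_step t j : j.+1 < dist dd -> paired t j -> paired (t + 3) j.+1.
Proof.
move=> jd pj; have db := dist_bounds dd.
have [mk Pb Pc [Mb Mc]] := pair_probe (ltnW jd) pj.
have safe : nd (offd n dd j) != vb by apply: nd_offd_safe; lia.
have safe' : nd (offd n dd j.+1) != vb by apply: nd_offd_safe; lia.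
have ab : act t.+1 b (nd (offd n dd j.+1)) = (Check true dd, idfun, dir_action (~~ dd)).
  by rewrite /performed Mb /= struck_board_safe // (marked_fresh mk jd) eqxx.
have ac : act t.+1 c' (nd (offd n dd j)) = (Check false dd, idfun, Stay).
  by rewrite /performed Mc.
have Pb1 := struck_pos_safe safe' Pb; have Pc1 := struck_pos_safe safe Pc.
have [Pb' Mb'] := next_agent n3 orderP Pb1; have [Pc' Mc'] := next_agent n3 orderP Pc1.
rewrite ab ac /= move_back in Pb' Mb' Pc' Mc'; last by lia.
have mk' : marked t.+2.
  apply: marked_next => // i v ia; case/orP: (third ba ca bc ia) => /eqP->.
    by rewrite Pb1 => -[<-]; rewrite ab.
  by rewrite Pc1 => -[<-]; rewrite ac.
have Pb2 := struck_pos_safe safe Pb'; have Pc2 := struck_pos_safe safe Pc'.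
have ab' : act t.+2 b (nd (offd n dd j)) = (Advance true dd, idfun, dir_action dd).
  by rewrite /performed Mb'.
have ac' : act t.+2 c' (nd (offd n dd j)) = (Advance false dd, idfun, dir_action dd).
  rewrite /performed Mc' /= (present_alone ident_inj Pc2); case: forallP => // /(_ b).
  by rewrite bc Pb2 eqxx.
have [Pb3 Mb3] := next_agent n3 orderP Pb2; have [Pc3 Mc3] := next_agent n3 orderP Pc2.
rewrite ab' ac' move_dir in Pb3 Mb3 Pc3 Mc3; last by lia.
rewrite addn3; split=> //; apply: marked_next => // i v ia.
case/orP: (third ba ca bc ia) => /eqP->.
  by rewrite Pb2 => -[<-]; rewrite ab'.
by rewrite Pc2 => -[<-]; rewrite ac'.
Qed.

(** At the black hole the probing agent is destroyed, or reads a stale mark and walks on; in both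
    cases its partner finds itself alone. *)
Lemma pair_end t j : j.+1 = dist dd -> paired t j ->
  P (t + 3) c' = Some (nd (offd n dd j)) /\
  md (t + 3) c' = Explore (~~ dd) (inord (n - 2)).
Proof.
move=> jd pj; have db := dist_bounds dd.
have jd' : j < dist dd by rewrite -jd.
have [mk Pb Pc [Mb Mc]] := pair_probe jd' pj.
have safe : nd (offd n dd j) != vb by apply: nd_offd_safe; lia.
have at_vb : nd (offd n dd j.+1) = vb by apply/eqP; rewrite nd_offd_vb; lia.
have Pc1 := struck_pos_safe safe Pc.
have ac : act t.+1 c' (nd (offd n dd j)) = (Check false dd, idfun, Stay).
  by rewrite /performed Mc.
have [Pc' Mc'] := next_agent n3 orderP Pc1; rewrite ac /= in Pc' Mc'.
have Pc2 := struck_pos_safe safe Pc'.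
have left_b : P' t.+2 b != Some (nd (offd n dd j)).
  apply/eqP => /struck_pos_Some; case Pb1: (P' t.+1 b) => [v|];
    last by rewrite (next_dead orderP Pb1).
  have := struck_pos_Some Pb1; rewrite Pb => -[Ev]; rewrite -Ev in Pb1.
  have [-> _] := next_agent n3 orderP Pb1.
  rewrite /performed Mb /= at_vb; case: ifP => [/eqP stale|_].
    have := marked_stale mk.
    by have [E|E] := struck_board_cases ident start vb active erase order t.+1 vb;
      rewrite E in stale => //; rewrite stale eqxx.
  rewrite -at_vb move_dir; last by lia.
  (* A surviving probing agent is two nodes ahead of its partner, hence elsewhere because
     [n >= 3]. *)
  have o1 : off (nd (offd n dd j)) = off (nd (offd n dd j.+2)) -> False.
    rewrite !off_nd /offd; case: (dd) db jd jd' => db jd jd'; last first.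
      rewrite (modn_small (m := n - j.+2)); last by lia.
      have [j0|j0] := eqVneq j 0; first by rewrite j0 subn0 modnn; lia.
      by rewrite modn_small; lia.
    rewrite modn_small; last by lia.
    have [j2|j2] := eqVneq j.+2 n; first by rewrite j2 modnn; lia.
    by rewrite modn_small; lia.
  by case=> E; apply: o1; rewrite E.
have ac' : act t.+2 c' (nd (offd n dd j)) = (Explore (~~ dd) (inord (n - 2)), idfun, Stay).
  rewrite /performed Mc' /= (present_alone ident_inj Pc2).
  case: forallP => //; case=> i; apply/implyP => ic.
  have [->|ia] := eqVneq i a;
    first by rewrite struck_pos_None // -addn1 dead_forever // (marked_dead mk).
  by case/orP: (third ba ca bc ia) => /eqP E; rewrite E ?left_b // in ic *; rewrite eqxx in ic.
by rewrite addn3; have [-> ->] := next_agent n3 orderP Pc2; rewrite ac'.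
Qed.

Lemma pair_explores t : paired t 0 -> exists t', exists j, [/\ j.+1 = dist dd,
  P t' c' = Some (nd (offd n dd j)) & md t' c' = Explore (~~ dd) (inord (n - 2))].
Proof.
move=> p0; have db := dist_bounds dd.
have reach j : j < dist dd -> paired (t + j * 3) j.
  elim: j => [|j IH] jd; first by rewrite addn0.
  by rewrite mulSn (addnC 3) addnA; apply: pair_step (IH (ltnW jd)).
have Ej : (dist dd).-1.+1 = dist dd by lia.
have lt_j : (dist dd).-1 < dist dd by lia.
have [Pc Mc] := pair_end Ej (reach _ lt_j).
by exists (t + (dist dd).-1 * 3 + 3), (dist dd).-1.
Qed.

End Pair.

(** * Sweeps of the path obtained by removing the black hole *)

Section Explorer.

Variable i : 'I_3.

(** The path has [n - 1] nodes; [j] is the rank in a sweep in direction [e] that starts next to the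
    black hole. *)
Definition beyond e j := nd (off vb + offd n e j.+1).

Record exploring t e j : Prop := Exploring {
  expl_lt : j < n - 2;
  expl_pos : P t i = Some (beyond e j);
  expl_md : md t i = Explore e (inord (n - 2 - j)) }.

Lemma nd_off_vb_add m : 0 < m < n -> nd (off vb + m) != vb.
Proof.
move=> mn; have bn := off_lt ha vb; apply/eqP => /(congr1 off); rewrite off_nd.
have [lt|ge] := ltnP (off vb + m) n; first by rewrite modn_small; lia.
by rewrite -(subnK ge) modnDr modn_small; lia.
Qed.

Lemma beyond_safe e j : j < n.-1 -> beyond e j != vb.
Proof. by move=> jn; apply: nd_off_vb_add; rewrite /offd; case: e; lia. Qed.

Lemma beyond_flip e : beyond e (n - 2) = beyond (~~ e) 0.
Proof. by rewrite /beyond; case: e => /=; congr nd; lia. Qed.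

Lemma exploring_next t e j : exploring t e j ->
  P t.+1 i = Some (beyond e j.+1) /\
  (if j.+1 == n - 2 then exploring t.+1 (~~ e) 0 else exploring t.+1 e j.+1).
Proof.
move=> [jn Pi Mi].
have safe : beyond e j != vb by apply: beyond_safe; lia.
have [Pi' Mi'] := next_agent n3 orderP (struck_pos_safe safe Pi).
have move_beyond : move_to (beyond e j) (dir_action e) = beyond e j.+1.
  rewrite /beyond; case: (e); rewrite [dir_action _]/= ?move_right ?move_left /offd.
  - by congr nd; lia.
  - by congr nd; lia.
  - by lia.
have vk : val (inord (n - 2 - j) : 'I_n.+1) = n - 2 - j by rewrite /= inordK; lia.
rewrite /performed Mi /= move_beyond in Pi' Mi'; rewrite vk in Mi'.
split=> //; case: eqP => jE; split; rewrite ?Pi' ?Mi' //; try lia.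
- by rewrite jE beyond_flip.
- by rewrite subn0; have -> : n - 2 - j <= 1 by lia.
- have -> : (n - 2 - j <= 1) = false by lia.
  by congr Explore; congr inord; lia.
Qed.

Lemma exploring_ever t e j t' : exploring t e j -> t <= t' -> exists e' j', exploring t' e' j'.
Proof.
move=> H /subnKC <-; elim: (t' - t) => [|k [e' [j' /exploring_next[_]]]].
  by exists e, j; rewrite addn0.
by rewrite addnS; case: ifP => _ H'; [exists (~~ e'), 0 | exists e', j'.+1].
Qed.

Lemma exploring_turn t e j : exploring t e j -> exists2 t', t <= t' & exploring t' (~~ e) 0.
Proof.
have [m] := ubnP (n - j); elim: m t j => // m IH t j lm H; have jn := expl_lt H.
have [_] := exploring_next H; case: eqP => jE H'; first by exists t.+1.
have [|t' le_t H''] := IH t.+1 j.+1 _ H'; first by lia.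
by exists t' => //; apply: ltnW.
Qed.

Lemma exploring_reach t e j : j <= n - 2 -> exploring t e 0 ->
  P (t + j) i = Some (beyond e j) /\ (j < n - 2 -> exploring (t + j) e j).
Proof.
move=> jn H; elim: j jn => [|j IH] jn; first by rewrite addn0 (expl_pos H).
have [_ /(_ jn) H'] := IH (ltnW jn); rewrite addnS.
have [-> H''] := exploring_next H'; split=> // lt_j.
by move: H''; case: eqP => //; lia.
Qed.

Lemma exploring_visits t e j v t0 : exploring t e j -> v != vb ->
  exists2 t', t0 <= t' & P t' i = Some v.
Proof.
move=> H vvb.
have [e1 [j1 H1]] := exploring_ever H (leq_maxl t t0).
(* The first turn after [t0] begins a complete sweep. *)
have [t2 le2 H2] := exploring_turn H1; set e2 := ~~ e1 in H2.
have [m mn Ev] : exists2 m, 0 < m < n & v = nd (off vb + m).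
  have vn := off_lt ha v; have bn := off_lt ha vb.
  have ne : off v != off vb.
    by apply: contra vvb => /eqP E; rewrite -(nd_off ha v) E nd_off.
  have [lt|ge] := ltnP (off vb) (off v).
    by exists (off v - off vb); [lia | rewrite subnKC ?nd_off // ltnW].
  exists (off v + n - off vb); first by lia.
  rewrite subnKC; last by lia.
  by rewrite -[RHS](nd_off ha) off_nd modnDr modn_small // nd_off.
(* Rank in the sweep of the node lying [m] steps to the right of the black hole. *)
pose k := if e2 then m.-1 else n - m.+1.
have [|Pk _] := @exploring_reach t2 e2 k _ H2; first by rewrite /k; case: (e2); lia.
exists (t2 + k); first by have := leq_maxr t t0; lia.
rewrite Pk Ev; congr Some; rewrite /beyond /k; case: (e2) => /=; congr nd; lia.
Qed.

End Explorer.

(** * Every safe node is visited infinitely often *)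

Lemma other_agents : exists b c', [/\ b != a, c' != a,
  b != c' & val (ident b) < val (ident c')].
Proof.
have [ba ca bc] : [/\ ordS a != a, ordS (ordS a) != a & ordS a != ordS (ordS a)].
  by case: a => -[|[|[|//]]].
case: (ltngtP (val (ident (ordS a))) (val (ident (ordS (ordS a))))) =>
  [lt|lt|/val_inj/ident_inj E].
- by exists (ordS a), (ordS (ordS a)).
- by exists (ordS (ordS a)), (ordS a); split; rewrite // eq_sym.
- by case/eqP: bc.
Qed.

Lemma explored v t0 : v != vb -> exists2 t, t0 <= t & exists i, P t i = Some v.
Proof.
move=> vvb; pose tau := maxn trip0 t0.
have tau0 : trip0 <= tau by apply: leq_maxl.
have t0_le : t0 <= tt tau 0 by have := leq_maxr trip0 t0; rewrite -/tau /tt; nia.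
have after_death : (exists dd tau' f, lost dd tau' f 0 /\
    forall i, i != a -> P (tt tau' 0) i = Some ha /\ exists d, md (tt tau' 0) i = Gather d) ->
    exists2 t, t0 <= t & exists i, P t i = Some v.
  case=> dd [tau' [f [H met]]]; have [b [c' [ba ca bc lt]]] := other_agents.
  have [t [j [jd Pc Mc]]] := pair_explores ba ca bc lt (pair_start ba ca bc lt H met).
  have db := dist_bounds dd.
  have [|t' le' Pt'] := @exploring_visits c' t (~~ dd) 0 v t0 _ vvb; last by exists t' => //;
    exists c'.
  split; [by lia | rewrite Pc; congr Some | by rewrite subn0].
  (* The partner left behind stands next to the black hole, where a sweep in direction [~~ dd]
     begins. *)
  rewrite /beyond; apply/eqP; have bn := off_lt ha vb; have b0 := off_vb_gt0.
  rewrite nd_eq; last by rewrite /offd; case: (dd); lia.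
  rewrite off_nd; move: jd; rewrite /dist /offd; case: (dd) => /= jd.
    have -> : off vb + (n - 1) = j + n by lia.
    by rewrite modnDr modn_small; lia.
  have [j0|j0] := eqVneq j 0; first by rewrite (_ : off vb + 1 = n) ?modnn; lia.
  by rewrite modn_small; lia.
(* If the explorer starts both trips [tau] and [tau.+1], its tour in trip [tau] was complete. *)
have [H|] := dead_or_touring tau0; last exact: after_death.
have [H'|] := dead_or_touring (leqW tau0); last exact: after_death.
have [|t le Pt] := @touring_visits tau v tau0 H; first by rewrite (tour_pos H').
by exists t; [apply: leq_trans le | exists a].
Qed.

End Alive.

Theorem ring_algorithm_solves c : solves_PerpExploration_BBH (ring_algorithm c).
Proof.
move=> n n3 ident ident_inj start vb safe active erase order orderP v vvb t.
pose a := [arg min_(i < ord0) val (ident i)].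
have a_min i : i != a -> val (ident a) < val (ident i).
  rewrite /a; case: arg_minnP => // m _ m_min im; rewrite ltn_neqAle m_min // andbT.
  by rewrite (inj_eq val_inj) (inj_eq ident_inj) eq_sym.
exact: (@explored _ _ ident start vb active erase order n3 ident_inj safe orderP a a_min v t
  vvb).
Qed.

(** * Fewer than three agents *)

Section Impossibility.

Variables (k c : nat) (A : algorithm k c).
Hypotheses (k_lt3 : k < 3) (c_gt0 : 0 < c) (A_solves : solves_PerpExploration_BBH A).

Notation node := 'I_4.
Notation conf :=
  (config k 4 ((mem_bits A 4).-tuple bool) ((wb_bits A 4).-tuple bool)).

Lemma id_bound : k <= (k ^ c).+1.
Proof.
case: (posnP k) => [->//|k0]; apply: leqW; rewrite -[X in X <= _]expn1.
by rewrite leq_pexp2l.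
Qed.

Definition ident_k (i : 'I_k) : agent_id k c := widen_ord id_bound i.
Definition home (i : 'I_k) : node := ord0.

Lemma ident_k_inj : injective ident_k.
Proof. by move=> i j /(congr1 val) /= E; apply: val_inj. Qed.

Definition run (u : node) (active : nat -> bool) t : conf :=
  config_at A ident_k home u active (fun=> false) (fun=> enum 'I_k) t.
Definition struck_run (u : node) (active : nat -> bool) t : conf :=
  strike u active (fun=> false) t (run u active t).

Lemma runS u active t : run u active t.+1 =
  foldl (turn ident_k (struck_run u active t)) (struck_run u active t) (enum 'I_k).
Proof. by []. Qed.

Lemma run_explores u active v t : u != ord0 -> v != u ->
  exists2 t', t <= t' & exists i, pos (run u active t') i = Some v.
Proof.
move=> u0 vu; apply: (A_solves (n := 4)) => //.
- exact: ident_k_inj.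
- by move=> i; rewrite eq_sym.
Qed.

Lemma pos_struck u active t i : pos (struck_run u active t) i =
  if active t && (pos (run u active t) i == Some u) then None else pos (run u active t) i.
Proof. by rewrite /struck_run /strike; case: (active t) => //=; rewrite ffunE. Qed.

Lemma mem_struck u active t : Defs.mem (struck_run u active t) = Defs.mem (run u active t).
Proof. by rewrite /struck_run /strike; case: (active t). Qed.

Lemma board_struck u active t : board (struck_run u active t) = board (run u active t).
Proof. by rewrite /struck_run /strike; case: (active t). Qed.

Lemma run_agent u active t i :
  if pos (struck_run u active t) i is Some v then exists a,
    pos (run u active t.+1) i = Some (move_to v a)
  else pos (run u active t.+1) i = None.
Proof.
have := @foldl_turn_agent _ _ A 4 ident_k (struck_run u active t) (struck_run u active t) _ i
  (enum_uniq 'I_k) erefl erefl.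
rewrite mem_enum inE -runS /=; case: (pos _ i) => [v|] /=; last by case.
by case=> v' [<-] [w [-> _]]; eexists.
Qed.

(** Death is permanent, while the safe node 0 must be visited again. *)
Lemma some_survivor u active t : u != ord0 ->
  ~ (forall i, pos (struck_run u active t) i = None).
Proof.
move=> u0 dead; have [|t' lt [i]] := @run_explores u active ord0 t.+1 u0;
  first by rewrite eq_sym.
move=> E; suff : forall s j, pos (run u active (t.+1 + s)) j = None.
  by move=> /(_ (t' - t.+1) i); rewrite subnKC // E.
elim=> [|s IH] j; first by have := run_agent u active t j; rewrite dead addn0.
have := run_agent u active (t.+1 + s) j.
by rewrite pos_struck IH andbF addnS.
Qed.

(** A dormant black hole leaves no trace, so the adversary may postpone the choice of its
    position. *)
Lemma run_inactive u u' active active' t :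
  (forall s, s < t -> active s = false) -> (forall s, s < t -> active' s = false) ->
  run u active t = run u' active' t.
Proof.
elim: t => // t IH h h'.
have E : run u active t = run u' active' t by apply: IH => s st; rewrite ?h ?h' // leqW.
by rewrite !runS /struck_run /strike h // h' // E.
Qed.

(** A lone agent finds the board of its snapshot, so its step is determined by its memory and that
    board. *)
Lemma foldl_turn_alone (s : conf) (l : seq 'I_k) b v : uniq l -> pos s b = Some v ->
  (forall j, pos s j = Some v -> j = b) ->
  let s'' := foldl (turn ident_k s) s l in
  let u := step (ident_k b) (Defs.mem s b) (ids_at ident_k s v) (board s v) (board s v) in
  [/\ pos s'' b = (if b \in l then Some (move_to v u.2) else Some v),
      Defs.mem s'' b = (if b \in l then u.1.1 else Defs.mem s b) &
      board s'' v = (if b \in l then u.1.2 else board s v)].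
Proof.
move=> + Pb alone; elim/last_ind: l => [|l j IH] //.
rewrite rcons_uniq -cats1 foldl_cat /= => /andP[jl Ul]; have [] := IH Ul.
set s1 := foldl _ _ _ => p1 m1 b1; rewrite mem_cat mem_seq1 /turn.
have [E|bj] := eqVneq b j.
  rewrite -E in jl *; rewrite orbT Pb b1 (negbTE jl).
  by case: (step _ _ _ _ _) => [[m w] a] /=; rewrite ?ffunE ?eqxx.
rewrite orbF; case Pj: (pos s j) => [v'|] //; case: (step _ _ _ _ _) => [[m w] a] /=.
rewrite !ffunE (negbTE bj); have [vv'|//] := eqVneq v v'.
by rewrite -vv' in Pj; rewrite (alone j Pj) eqxx in bj.
Qed.

Lemma foldl_turn_empty (s : conf) (l : seq 'I_k) v : (forall j, pos s j != Some v) ->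
  board (foldl (turn ident_k s) s l) v = board s v.
Proof.
move=> none; rewrite foldl_turn_board; elim: l {2 3}(board s v) => //= j l IH w.
by rewrite (negbTE (none j)) IH.
Qed.

(** * Two indistinguishable deaths *)

Section Two.

Variables a b : 'I_k.
Hypothesis ab : forall j, j = a \/ j = b.

(** This is all that [b] can observe outside [u]. The boards at [u] may differ, since [a] may write
    there in one execution after having been destroyed in the other. *)
Record alike u (s1 s2 : conf) : Prop := Alike {
  alike_pos : pos s1 b = pos s2 b;
  alike_mem : Defs.mem s1 b = Defs.mem s2 b;
  alike_board : forall v, v != u -> board s1 v = board s2 v }.

Definition away u (s : conf) := (pos s a == None) || (pos s a == Some u).

(** With [a] destroyed or at [u], agent [b] is alone at [w] in both configurations and takes the
    same step. *)
Lemma alike_turns u w (s1 s2 : conf) : alike u s1 s2 -> pos s1 b = Some w -> w != u ->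
  away u s1 -> away u s2 ->
  alike u (foldl (turn ident_k s1) s1 (enum 'I_k)) (foldl (turn ident_k s2) s2 (enum 'I_k)).
Proof.
move=> [p m bd] p1 wu a1 a2; have p2 : pos s2 b = Some w by rewrite -p.
have off s v : away u s -> v != u -> pos s a != Some v.
  by move=> /orP[] /eqP-> // vu; rewrite (inj_eq (@Some_inj _)) eq_sym.
have alone s : away u s -> forall j, pos s j = Some w -> j = b.
  by move=> aw j Pj; case: (ab j) => // ja; have := off s w aw wu; rewrite -ja Pj eqxx.
have idsE s : away u s -> pos s b = Some w -> ids_at ident_k s w = [set ident_k b].
  move=> aw Pb; apply/setP => y; rewrite inE; apply/imsetP/eqP => [[j]|->].
    by rewrite inE => /andP[_ /eqP /(alone s aw) ->].
  by exists b; rewrite // inE Pb eqxx.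
have [q1 n1 c1] := foldl_turn_alone (enum_uniq 'I_k) p1 (alone s1 a1).
have [q2 n2 c2] := foldl_turn_alone (enum_uniq 'I_k) p2 (alone s2 a2).
rewrite !mem_enum !inE !idsE // -?m -?(bd w wu) in q1 n1 c1 q2 n2 c2.
split=> [||v vu]; rewrite ?q1 ?q2 ?n1 ?n2 //.
have [->|vw] := eqVneq v w; first by rewrite c1 c2.
have none s : away u s -> pos s b = Some w -> forall j, pos s j != Some v.
  move=> aw Pb j; case: (ab j) => ->; first exact: off.
  by rewrite Pb (inj_eq (@Some_inj _)) eq_sym.
by rewrite !foldl_turn_empty ?bd //; apply: none.
Qed.

Notation calm := (fun _ : nat => false).

Lemma no_step t u u' : u != ord0 -> u' != ord0 -> u != u' ->
  pos (run ord0 calm t) a = Some u -> pos (run ord0 calm t.+1) a = Some u' -> False.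
Proof.
move=> u0 u'0 uu' Pa Pa'.
(* In [X] the black hole [u] wakes in round [t] and destroys [a] there; in [Y] the black hole [u']
   wakes one round later and destroys [a] on its arrival. *)
pose X := run u (fun s => t <= s); pose X' := struck_run u (fun s => t <= s).
pose Y := run u' (fun s => t < s); pose Y' := struck_run u' (fun s => t < s).
have Xt : X t = run ord0 calm t by apply: run_inactive => // s; lia.
have Yt : Y t = run ord0 calm t by apply: run_inactive => // s; lia.
have Yt1 : Y t.+1 = run ord0 calm t.+1 by apply: run_inactive => // s; lia.
have Y'E : Y' t = Y t by rewrite /Y' /struck_run /strike ltnn.
have X'a : pos (X' t) a = None by rewrite pos_struck leqnn -/(X t) Xt Pa eqxx.
have liveX s : pos (X' s) a = None -> pos (X' s) b <> None.
  by move=> da db; apply: (some_survivor u0) => i; case: (ab i) => ->; [exact: da | exact: db].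
have liveY s : pos (Y' s) a = None -> pos (Y' s) b <> None.
  by move=> da db; apply: (some_survivor u'0) => i; case: (ab i) => ->; [exact: da | exact: db].
have X'b s : t <= s -> pos (X' s) b <> None ->
    pos (X s) b = pos (X' s) b /\ pos (X' s) b <> Some u.
  by rewrite pos_struck -/(X s) => -> /=; case: eqP.
(* In [X] a visit of [b] to [u] would leave no survivor, so [b] avoids [u] forever and the two
   executions stay alike. *)
have inv s : [/\ alike u (X' (t + s)) (Y' (t + s)), pos (X' (t + s)) a = None,
    away u (Y' (t + s)), s <> 0 -> pos (Y' (t + s)) a = None &
    exists2 w, pos (X' (t + s)) b = Some w & w != u].
  elim: s => [|s [sim da aw dY [w Pw wu]]].
    rewrite addn0; have [Xb Xbu] := X'b t (leqnn t) (liveX t X'a).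
    split=> //.
    - split; first by rewrite -Xb Y'E Xt Yt.
        by rewrite mem_struck Y'E -/(X t) Xt Yt.
      by move=> v _; rewrite board_struck Y'E -/(X t) Xt Yt.
    - by rewrite /away Y'E Yt Pa eqxx orbT.
    case E: (pos (X' t) b) Xbu => [w|] Xbu; last by have := liveX t X'a.
    by exists w => //; apply/eqP => wu; rewrite wu in Xbu.
  have awX : away u (X' (t + s)) by rewrite /away da.
  have := alike_turns sim Pw wu awX aw; rewrite -!runS -addnS -/(X _) -/(Y _) => -[p m bd].
  have le_t : t <= t + s.+1 by apply: leq_addr.
  have lt_t : t < t + s.+1 by lia.
  have da' : pos (X' (t + s.+1)) a = None.
    have := run_agent u (fun s => t <= s) (t + s) a; rewrite -/(X' (t + s)) da -addnS => E.
    by rewrite pos_struck E andbF.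
  have db' : pos (Y' (t + s.+1)) a = None.
    rewrite pos_struck lt_t -/(Y (t + s.+1)) /=.
    have [s0|s0] := eqVneq s 0; first by rewrite s0 addn1 Yt1 Pa' eqxx.
    have := run_agent u' (fun s => t < s) (t + s) a; rewrite -/(Y' (t + s)) dY -?addnS.
      by rewrite -/(Y _) => ->.
    exact/eqP.
  have [Xb Xbu] := X'b _ le_t (liveX _ da').
  have Yb : pos (Y' (t + s.+1)) b = pos (Y (t + s.+1)) b.
    by have := liveY _ db'; rewrite pos_struck lt_t -/(Y (t + s.+1)) /=; case: eqP.
  split=> //.
  - split; first by rewrite -Xb p Yb.
      by rewrite !mem_struck.
    by move=> v vu; rewrite !board_struck bd.
  - by rewrite /away db'.
  case E: (pos (X' (t + s.+1)) b) Xbu => [w'|] Xbu; last by have := liveX _ da'.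
  by exists w' => //; apply/eqP => wu'; rewrite wu' in Xbu.
(* In [Y] the node [u] is safe and must be visited again, but [a] is dead and [b] avoids [u] as in
   [X]. *)
have [t' le_t' [i Pi]] := @run_explores u' (fun s => t < s) u t.+2 u'0 uu'.
have [[p _ _] da _ dY [w Pw wu]] := inv (t' - t).
rewrite subnKC in p da dY Pw; last by lia.
have {}dY : pos (Y' t') a = None by apply: dY; lia.
have tt' : t < t' by lia.
case: (ab i) Pi => -> Pi.
  by move: dY; rewrite pos_struck tt' Pi (inj_eq (@Some_inj _)) (negbTE uu').
by move: p; rewrite Pw pos_struck tt' Pi (inj_eq (@Some_inj _)) (negbTE uu') => -[E];
  rewrite E eqxx in wu.
Qed.

End Two.

Lemma no_solution : False.
Proof.
have v1 : (1 < 4) by []. have v2 : (2 < 4) by [].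
pose u1 : node := Ordinal v1; pose u2 : node := Ordinal v2.
have calm_run u t : run u (fun=> false) t = run ord0 (fun=> false) t by apply: run_inactive.
have alive t i : pos (run ord0 (fun=> false) t) i != None.
  elim: t => [|t IH]; first by rewrite /run /= ffunE.
  have := run_agent ord0 (fun=> false) t i; rewrite pos_struck /=.
  by case: (pos _ i) IH => // v _ [x ->].
have not_all_at t u : u != ord0 -> ~ forall i, pos (run ord0 (fun=> false) t) i = Some u.
  move=> u0 at_u; apply: (@some_survivor u (fun s => t <= s) t u0) => i.
  have E : run u (fun s => t <= s) t = run ord0 (fun=> false) t.
    by apply: run_inactive => // s; lia.
  by rewrite pos_struck leqnn E at_u eqxx.
have reached : exists t, [exists i, pos (run ord0 (fun=> false) t) i == Some u2].
  have [||t _ [i Pi]] := @run_explores u1 (fun=> false) u2 0 => //.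
  by exists t; apply/existsP; exists i; rewrite -(calm_run u1) Pi.
(* At the first arrival at node 2, the visitor comes from a node other than 2 by minimality, and
   other than 0 because 0 and 2 are not adjacent. *)
case: (ex_minnP reached) => -[|t] /existsP[a /eqP Pa] t_min.
  by move: Pa; rewrite /run /= ffunE => -[].
have [u Pu] : exists u, pos (run ord0 (fun=> false) t) a = Some u.
  by have := alive t a; case: (pos _ a) => // u _; exists u.
have uu2 : u != u2.
  apply/eqP => E; have /t_min : [exists i, pos (run ord0 (fun=> false) t) i == Some u2].
    by apply/existsP; exists a; rewrite Pu E.
  by rewrite ltnn.
have u_neq0 : u != ord0.
  have := run_agent ord0 (fun=> false) t a; rewrite pos_struck /= Pu Pa => -[x [E]].
  apply/eqP => u0; move: E; rewrite u0 => /(congr1 val); by case: x.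
have [[b ab]|alone] : (exists b, forall j, j = a \/ j = b) \/ forall j, j = a.
  case: (pickP (fun b => b != a)) => [b ba|none]; [left; exists b | right] => j.
    have [|ja] := eqVneq j a; first by left.
    right; apply: val_inj; move: ba ja; rewrite -!(inj_eq val_inj) /=.
    by have := ltn_ord a; have := ltn_ord b; have := ltn_ord j; lia.
  by apply/eqP; have := none j; case: eqP.
- exact: (no_step ab (t := t) u_neq0 _ uu2 Pu Pa).
(* A single agent standing away from node 0 is destroyed by a black hole placed under it. *)
- by apply: (not_all_at t u u_neq0) => j; rewrite (alone j).
Qed.

End Impossibility.

Theorem theorem13 (c : nat) (hc : 0 < c) :
  (exists A : algorithm 3 c, log_space A /\ solves_PerpExploration_BBH A) /\
  (forall k : nat, k < 3 ->
     ~ exists A : algorithm k c, log_space A /\ solves_PerpExploration_BBH A).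
Proof.
split.
  exists (ring_algorithm c); split; first exact: log_space_ring_algorithm.
  exact: ring_algorithm_solves.
by move=> k k3 [A [_ A_solves]]; apply: (no_solution k3 hc A_solves).
Qed.
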